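(* Let $k$ be a field of characteristic $p>0$. Let $F=(G,\chi,c,a,(\alpha_{-1},\alpha_0))$ be a tuple where $G$ is a finite group, $a\in Z(G)$, $\chi:G\to k^*$ is a linear character with $\chi(a)=1$, $c:G\to k$ is a map with $c(hg)=\chi(g)c(h)+c(g)$ for all $g,h\in G$ and $c(a)=0$, and $\alpha_{-1},\alpha_0\in k$ satisfy $\alpha_0\in\{0,1\}$ and ($\alpha_0=0\Rightarrow\alpha_{-1}=0$). Assume moreover that (1) if $\alpha_0=0$, then $c(g)(a^p-1)=0$ in $kG$ for all $g\in G$; (2) if $\alpha_0=1$, then $a^p=a$, and $\chi(g)\in\mathbb{F}_p^*$ and $(\alpha_{-1}(\chi(g)-1)+c(g)^p-c(g))(a-1)=0$ in $kG$ for all $g\in G$. Then the Hopf algebra $H_F$ is well-defined: the $k$-algebra generated by $kG$ and an element $x$ subject to the relations $x^p=\alpha_{-1}(a^p-1)+\alpha_0x$ and $gxg^{-1}=\chi(g)x+c(g)(a-1)$ for all $g\in G$ has $\{gx^i: g\in G,\ 0\le i\le p-1\}$ as a $k$-basis, and it is a Hopf algebra with the linear structure maps determined by $\Delta(gx^i)=(g\otimes g)(x\otimes a+1\otimes x)^i$, $\epsilon(gx^i)=\delta_{i,0}$ and $S(gx^i)=(-xa^{-1})^ig^{-1}$ for all $g\in G$ and $0\le i\le p-1$.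
   Context: $\mathbb{F}_p$ denotes the prime field of $k$ and $Z(G)$ the center of $G$. *)

(* Defs.v *)
From HB Require Import structures.
From mathcomp Require Import all_boot all_order all_fingroup all_algebra.
From mathcomp Require Import all_solvable.
From mathcomp Require Import generic_quotient ring_quotient.
From mathcomp Require Import boolp.
From mathcomp Require Import finmap monalg.

Set Implicit Arguments.
Unset Strict Implicit.
Unset Printing Implicit Defensive.

Import GRing.Theory.
Local Open Scope ring_scope.
Local Open Scope quotient_scope.

Section Span.
Variables (k : fieldType) (V : lmodType k) (S : V -> Prop).

Inductive in_span : V -> Prop :=
| span_gen u of S u : in_span u
| span_zero : in_span 0
| span_comb b u v of in_span u & in_span v : in_span (b *: u + v).

Definition spanp : {pred V} := fun u => `[< in_span u >].

Lemma spanp_submod_closed : submod_closed spanp.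
Proof.
split=> [|b u v /asboolP uS /asboolP vS]; apply/asboolP; first exact: span_zero.
exact: span_comb.
Qed.

HB.instance Definition _ := GRing.isSubmodClosed.Build k V spanp
  spanp_submod_closed.

End Span.

Notation lquot S := (Quotient.quot (spanp S)).

Section LmodQuotient.
Variables (k : fieldType) (V : lmodType k) (S : V -> Prop).

Local Notation Q := (lquot S).

Lemma lquotP (u v : V) : reflect (\pi_Q u = \pi_Q v) (u - v \in spanp S).
Proof. by rewrite Quotient.idealrBE; apply: eqP. Qed.

Lemma lquotD (u v : V) : \pi_Q (u + v) = \pi_Q u + \pi_Q v.
Proof. by rewrite !piE. Qed.

Definition lquot_scale (b : k) (u : Q) : Q := \pi_Q (b *: repr u).

Lemma lquot_scale_pi b (u : V) : lquot_scale b (\pi_Q u) = \pi_Q (b *: u).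
Proof.
apply/lquotP; rewrite -scalerBr rpredZ //; apply/lquotP.
by rewrite reprK.
Qed.

Lemma lquot_scalerA a b u :
  lquot_scale a (lquot_scale b u) = lquot_scale (a * b) u.
Proof. by elim/quotW: u => u; rewrite (lquot_scale_pi b) !lquot_scale_pi scalerA. Qed.

Lemma lquot_scale1r : left_id 1 lquot_scale.
Proof. by elim/quotW=> u; rewrite lquot_scale_pi scale1r. Qed.

Lemma lquot_scalerDr : right_distributive lquot_scale +%R.
Proof.
move=> b; elim/quotW=> u; elim/quotW=> v.
by rewrite -lquotD !lquot_scale_pi -lquotD scalerDr.
Qed.

Lemma lquot_scalerDl u : {morph lquot_scale^~ u : a b / a + b}.
Proof.
by move=> a b; elim/quotW: u => u; rewrite !lquot_scale_pi -lquotD scalerDl.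
Qed.

HB.instance Definition _ := GRing.Zmodule_isLmodule.Build k Q
  lquot_scalerA lquot_scale1r lquot_scalerDr lquot_scalerDl.

Lemma lquotZ b (u : V) : \pi_Q (b *: u) = b *: \pi_Q u.
Proof. by rewrite -lquot_scale_pi. Qed.

End LmodQuotient.

Section AlgQuotient.
Variables (k : fieldType) (A : algType k) (S : A -> Prop).

(* The spanning set of the two-sided ideal generated by S. *)
Definition ideal_gen (w : A) : Prop :=
  exists u s v, S s /\ w = u * s * v.

Lemma ideal_mull u w : w \in spanp ideal_gen -> u * w \in spanp ideal_gen.
Proof.
move=> /asboolP wS; apply/asboolP; elim: wS => [_ [v [s [v' [sS ->]]]]||b w1 w2 _ h1 _ h2].
- by apply: span_gen; exists (u * v), s, v'; rewrite !mulrA.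
- by rewrite mulr0; apply: span_zero.
- by rewrite mulrDr -scalerAr; apply: span_comb.
Qed.

Lemma ideal_mulr u w : w \in spanp ideal_gen -> w * u \in spanp ideal_gen.
Proof.
move=> /asboolP wS; apply/asboolP; elim: wS => [_ [v [s [v' [sS ->]]]]||b w1 w2 _ h1 _ h2].
- by apply: span_gen; exists v, s, (v' * u); rewrite !mulrA.
- by rewrite mul0r; apply: span_zero.
- by rewrite mulrDl -scalerAl; apply: span_comb.
Qed.

Definition alg_quot := lquot ideal_gen.
Local Notation Q := alg_quot.

HB.instance Definition _ := GRing.Lmodule.on alg_quot.

Definition aproj (u : A) : Q := \pi_(lquot ideal_gen) u.

Lemma aprojP u v : reflect (aproj u = aproj v) (u - v \in spanp ideal_gen).
Proof. exact: lquotP. Qed.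

Lemma aproj_surj (q : Q) : exists u, q = aproj u.
Proof. by exists (repr (q : lquot ideal_gen)); rewrite /aproj reprK. Qed.

Lemma aproj_is_linear : linear aproj.
Proof. by move=> b u v; rewrite /aproj lquotD lquotZ. Qed.

HB.instance Definition _ := GRing.isLinear.Build k A Q *:%R aproj
  aproj_is_linear.

Definition aquot_mul (q r : Q) : Q :=
  aproj (repr (q : lquot ideal_gen) *
         repr (r : lquot ideal_gen)).

Lemma aquot_mul_proj u v : aquot_mul (aproj u) (aproj v) = aproj (u * v).
Proof.
apply/aprojP.
set u' := repr _; set v' := repr _.
have uS : u' - u \in spanp ideal_gen by apply/aprojP; rewrite /aproj reprK.
have vS : v' - v \in spanp ideal_gen by apply/aprojP; rewrite /aproj reprK.
have -> : u' * v' - u * v = (u' - u) * v' + u * (v' - v).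
  by rewrite mulrBl mulrBr addrA subrK.
by apply: rpredD; [apply: ideal_mulr | apply: ideal_mull].
Qed.

Lemma aquot_mulA : associative aquot_mul.
Proof.
move=> q r s; have [u ->] := aproj_surj q; have [v ->] := aproj_surj r.
have [w ->] := aproj_surj s.
by rewrite (aquot_mul_proj u v) (aquot_mul_proj v w) !aquot_mul_proj mulrA.
Qed.

Lemma aquot_mul1l : left_id (aproj 1) aquot_mul.
Proof. by move=> q; have [u ->] := aproj_surj q; rewrite aquot_mul_proj mul1r. Qed.

Lemma aquot_mul1r : right_id (aproj 1) aquot_mul.
Proof. by move=> q; have [u ->] := aproj_surj q; rewrite aquot_mul_proj mulr1. Qed.

Lemma aquot_mulDl : left_distributive aquot_mul +%R.
Proof.
move=> q r s; have [u ->] := aproj_surj q; have [v ->] := aproj_surj r.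
have [w ->] := aproj_surj s.
by rewrite -raddfD !aquot_mul_proj mulrDl raddfD.
Qed.

Lemma aquot_mulDr : right_distributive aquot_mul +%R.
Proof.
move=> q r s; have [u ->] := aproj_surj q; have [v ->] := aproj_surj r.
have [w ->] := aproj_surj s.
by rewrite -raddfD !aquot_mul_proj mulrDr raddfD.
Qed.

HB.instance Definition _ := GRing.Zmodule_isPzRing.Build Q
  aquot_mulA aquot_mul1l aquot_mul1r aquot_mulDl aquot_mulDr.

Lemma aproj_is_monoid_morphism : monoid_morphism aproj.
Proof. by split=> // u v; rewrite -aquot_mul_proj. Qed.

HB.instance Definition _ := GRing.isMonoidMorphism.Build A Q aproj
  aproj_is_monoid_morphism.

Lemma aquot_scalerAl b (q r : Q) : b *: (q * r) = (b *: q) * r.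
Proof.
have [u ->] := aproj_surj q; have [v ->] := aproj_surj r.
transitivity (aproj (b *: (u * v))); first by rewrite linearZ rmorphM.
by rewrite scalerAl rmorphM /= linearZ.
Qed.

Lemma aquot_scalerAr b (q r : Q) : b *: (q * r) = q * (b *: r).
Proof.
have [u ->] := aproj_surj q; have [v ->] := aproj_surj r.
transitivity (aproj (b *: (u * v))); first by rewrite linearZ rmorphM.
by rewrite scalerAr rmorphM /= linearZ.
Qed.

End AlgQuotient.

Section FreeAlgebra.
Variables (k : fieldType) (I : choiceType).

Definition free_alg := {malg k[{fmonom I}]}.

HB.instance Definition _ := GRing.Lalgebra.on free_alg.

Lemma free_alg_scalerAr b (u v : free_alg) : b *: (u * v) = u * (b *: v).
Proof.
have commC w : w * b%:MP = b%:MP * w :> {malg k[{fmonom I}]}.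
  rewrite !malgM_def fgmulgU fgmulUg; apply: eq_bigr => i _.
  by rewrite mulm1 mul1m mulrC.
by rewrite -!mul_malgC !mulrA commC.
Qed.

HB.instance Definition _ := GRing.Lalgebra_isAlgebra.Build k free_alg
  free_alg_scalerAr.

Definition fgen (i : I) : free_alg := << fmu i >>.

End FreeAlgebra.

Section LinearLemmas.
Variables (k : fieldType) (V W : lmodType k) (f : V -> W).
Hypothesis f_linear : linear f.

Lemma linear_at0 : f 0 = 0.
Proof. by have := f_linear (-1) 0 0; rewrite scaler0 add0r scaleN1r addNr. Qed.

Lemma linear_atD u v : f (u + v) = f u + f v.
Proof. by have := f_linear 1 u v; rewrite !scale1r. Qed.

Lemma linear_atZ b u : f (b *: u) = b *: f u.
Proof. by have := f_linear b u 0; rewrite linear_at0 !addr0. Qed.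

Lemma linear_ext (g : V -> W) : g =1 f -> linear g.
Proof. by move=> gf b u v; rewrite !gf f_linear. Qed.

End LinearLemmas.

Section LinearExtension.
Variables (k : fieldType) (K : choiceType) (W : lmodType k) (f : K -> W).

Definition mlift (u : {malg k[K]}) : W := \sum_(i <- msupp u) u@_i *: f i.

Lemma mliftEw (E : {fset K}) u :
  (msupp u `<=` E)%fset -> mlift u = \sum_(i <- E) u@_i *: f i.
Proof.
move=> le; rewrite /mlift (big_fset_incl _ le) => //= x _ /mcoeff_outdom ->.
by rewrite scale0r.
Qed.

Lemma mlift_is_linear : linear mlift.
Proof.
move=> b u v; set E := (msupp u `|` msupp v)%fset.
have uE : (msupp u `<=` E)%fset by apply: fsubsetUl.
have vE : (msupp v `<=` E)%fset by apply: fsubsetUr.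
have buE : (msupp (b *: u) `<=` E)%fset.
  exact: fsubset_trans (msuppZ_le _ _) uE.
rewrite !(@mliftEw E) //; last first.
  by apply: fsubset_trans (msuppD_le _ _) _; rewrite fsubUset buE.
rewrite scaler_sumr -big_split /=; apply: eq_bigr => i _.
by rewrite mcoeffD mcoeffZ scalerDl scalerA.
Qed.

HB.instance Definition _ := GRing.isLinear.Build k {malg k[K]} W *:%R mlift
  mlift_is_linear.

Lemma mliftU i : mlift << i >> = f i.
Proof. by rewrite (mliftEw msuppU_le) big_seq_fset1 mcoeffUU scale1r. Qed.

End LinearExtension.

Section TensorProduct.
Variables (k : fieldType) (U V : lmodType k).

Local Notation free_mod := {malg k[(U * V)%type]}.

Inductive tensor_rel : free_mod -> Prop :=
| tensor_rel_l b u u' v :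
    tensor_rel (<< (b *: u + u', v) >> - (b *: << (u, v) >> + << (u', v) >>))
| tensor_rel_r b u v v' :
    tensor_rel (<< (u, b *: v + v') >> - (b *: << (u, v) >> + << (u, v') >>)).

Definition tensor := lquot tensor_rel.

HB.instance Definition _ := GRing.Lmodule.on tensor.

Definition tproj (w : free_mod) : tensor :=
  \pi_(lquot tensor_rel) w.

Definition tens (u : U) (v : V) : tensor := tproj << (u, v) >>.

Lemma tprojP w w' :
  reflect (tproj w = tproj w') (w - w' \in spanp tensor_rel).
Proof. exact: lquotP. Qed.

Lemma tproj_surj (t : tensor) : exists w, t = tproj w.
Proof.
by exists (repr (t : lquot tensor_rel)); rewrite /tproj reprK.
Qed.

Lemma tproj_is_linear : linear tproj.
Proof. by move=> b u v; rewrite /tproj lquotD lquotZ. Qed.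

HB.instance Definition _ := GRing.isLinear.Build k free_mod tensor *:%R tproj
  tproj_is_linear.

Lemma tens_linearl v : linear (tens^~ v).
Proof.
move=> b u u'; rewrite /tens -linearP.
by apply/tprojP/asboolP/span_gen/tensor_rel_l.
Qed.

Lemma tens_linearr u : linear (tens u).
Proof.
move=> b v v'; rewrite /tens -linearP.
by apply/tprojP/asboolP/span_gen/tensor_rel_r.
Qed.

Definition bilin (W : lmodType k) (f : U -> V -> W) : Prop :=
  (forall v, linear (f^~ v)) /\ (forall u, linear (f u)).

Lemma tens_bilin : bilin tens.
Proof. by split; [apply: tens_linearl | apply: tens_linearr]. Qed.

(* The linear map on the tensor product induced by f; meaningful only when f   *)
(* is bilinear, see tlift_tens and tlift_is_linear.                            *)
Definition tlift (W : lmodType k) (f : U -> V -> W) (t : tensor) : W :=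
  mlift (fun p => f p.1 p.2) (repr (t : lquot tensor_rel)).

Section Lift.
Variables (W : lmodType k) (f : U -> V -> W).
Hypothesis f_bilin : bilin f.

Lemma tlift_proj w : tlift f (tproj w) = mlift (fun p => f p.1 p.2) w.
Proof.
apply/eqP; rewrite -subr_eq0 -raddfB /=; set d := _ - w; apply/eqP.
have /asboolP : d \in spanp tensor_rel by apply/tprojP; rewrite /tproj reprK.
elim=> [_ [b u u' v | b u v v'] | | b u v _ hu _ hv].
- by rewrite raddfB /= linearP /= !mliftU /= f_bilin.1 subrr.
- by rewrite raddfB /= linearP /= !mliftU /= f_bilin.2 subrr.
- exact: raddf0.
- by rewrite linearP /= hu hv scaler0 addr0.
Qed.

Lemma tlift_tens u v : tlift f (tens u v) = f u v.
Proof. by rewrite tlift_proj mliftU. Qed.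

Lemma tlift_is_linear : linear (tlift f).
Proof.
move=> b s t; have [u ->] := tproj_surj s; have [v ->] := tproj_surj t.
by rewrite -linearP !tlift_proj linearP.
Qed.

End Lift.

Lemma tensor_ind (P : tensor -> Prop) :
  P 0 -> (forall s t, P s -> P t -> P (s + t)) -> (forall u v, P (tens u v)) ->
  forall t, P t.
Proof.
move=> P0 PD Pt t; have [w ->] := tproj_surj t.
rewrite (monalgE w) raddf_sum /=; elim/big_ind: _ => // [[u v]] _.
have -> : << w@_(u, v) *g (u, v) >> = w@_(u, v) *: << (u, v) >> :> free_mod.
  by apply/malgP => m; rewrite mcoeffZ !mcoeffU mulrnAr mulr1.
rewrite linearZ /= -/(tens u v).
rewrite -(linear_atZ (tens_linearl v)).
exact: Pt.
Qed.

Lemma tlift_eq (W : lmodType k) (f g : tensor -> W) :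
  linear f -> linear g -> (forall u v, f (tens u v) = g (tens u v)) -> f =1 g.
Proof.
move=> fL gL fg.
elim/tensor_ind => [|s t hs ht|//]; first by rewrite !linear_at0.
by rewrite !linear_atD // hs ht.
Qed.

Lemma tens_family_linear (X W : lmodType k) (F : X -> tensor -> W) :
  (forall x, linear (F x)) -> (forall u v, linear (F^~ (tens u v))) ->
  forall t, linear (F^~ t).
Proof.
move=> FL Ft t b x y; elim/tensor_ind: t => [|s t hs ht|u v] /=.
- by rewrite !(linear_at0 (FL _)) scaler0 addr0.
- by rewrite !(linear_atD (FL _)) hs ht scalerDr addrACA.
- exact: Ft.
Qed.

End TensorProduct.

Notation "u ⊗ v" := (tens u v) (at level 40, left associativity) : ring_scope.

Section TensorMaps.
Variable k : fieldType.

Definition tmap (U U' V V' : lmodType k) (f : U -> U') (g : V -> V') :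
    tensor U V -> tensor U' V' :=
  tlift (fun u v => f u ⊗ g v).

Lemma tmap_tens (U U' V V' : lmodType k)
    (f : {linear U -> U'}) (g : {linear V -> V'}) u v :
  tmap f g (u ⊗ v) = f u ⊗ g v.
Proof.
by rewrite /tmap tlift_tens //; split=> w b x y /=;
  rewrite linearP (tens_linearl, tens_linearr).
Qed.

Definition tassoc (U V W : lmodType k) :
    tensor (tensor U V) W -> tensor U (tensor V W) :=
  tlift (fun s w => tlift (fun u v => u ⊗ (v ⊗ w)) s).

Lemma tassoc_tens (U V W : lmodType k) (u : U) (v : V) (w : W) :
  tassoc ((u ⊗ v) ⊗ w) = u ⊗ (v ⊗ w).
Proof.
have bil (w' : W) : bilin (fun (u' : U) (v' : V) => u' ⊗ (v' ⊗ w')).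
  by split=> x b y z /=; rewrite ?tens_linearl ?tens_linearr.
have L w' := tlift_is_linear (bil w').
rewrite /tassoc (@tlift_tens _ _ _ _ _ _ (u ⊗ v) w) ?tlift_tens //.
split=> [w' | s]; first exact: L.
apply: (tens_family_linear L) => u' v'.
apply: (@linear_ext _ _ _ (fun w' => u' ⊗ (v' ⊗ w'))) => [b x y | w'] /=.
  by rewrite !tens_linearr.
exact: (tlift_tens (bil w')).
Qed.

End TensorMaps.

Section TensorAlgebra.
Variables (k : fieldType) (A : lmodType k) (m : A -> A -> A) (u : A).

(* The product (a ⊗ b)(a' ⊗ b') = m a a' ⊗ m b b' on A ⊗ A, for a bilinear     *)
(* product m on A (see tmul_tens), and its powers, with unit u ⊗ u.            *)
Definition tmul (s t : tensor A A) : tensor A A :=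
  tlift (fun a b => tlift (fun a' b' => m a a' ⊗ m b b') t) s.

Definition texp (t : tensor A A) (n : nat) : tensor A A :=
  iter n (tmul t) (u ⊗ u).

Hypothesis m_bilin : bilin m.

Lemma tmul_bilinr a b : bilin (fun a' b' => m a a' ⊗ m b b').
Proof.
by split=> x c y z /=; rewrite m_bilin.2 (tens_linearl, tens_linearr).
Qed.

Lemma tmul_bilinl t : bilin (fun a b => tlift (fun a' b' => m a a' ⊗ m b b') t).
Proof.
have L a b := tlift_is_linear (tmul_bilinr a b).
split=> [b | a].
- apply: (tens_family_linear (L^~ b)) => a' b'.
  apply: (@linear_ext _ _ _ (fun a => m a a' ⊗ m b b')) => [c x y | a] /=.
    by rewrite m_bilin.1 tens_linearl.
  exact: (tlift_tens (tmul_bilinr a b)).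
- apply: (tens_family_linear (L a)) => a' b'.
  apply: (@linear_ext _ _ _ (fun b => m a a' ⊗ m b b')) => [c x y | b] /=.
    by rewrite m_bilin.1 tens_linearr.
  exact: (tlift_tens (tmul_bilinr a b)).
Qed.

Lemma tmul_tens a b a' b' : tmul (a ⊗ b) (a' ⊗ b') = m a a' ⊗ m b b'.
Proof.
by rewrite /tmul (tlift_tens (tmul_bilinl _)) (tlift_tens (tmul_bilinr _ _)).
Qed.

Lemma tmul_bilin : bilin tmul.
Proof.
split=> [t | s]; first exact/tlift_is_linear/tmul_bilinl.
apply: (tens_family_linear (fun t => tlift_is_linear (tmul_bilinl t))).
move=> a b; apply: (linear_ext (tlift_is_linear (tmul_bilinr a b))) => t /=.
exact: (tlift_tens (tmul_bilinl t)).
Qed.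

End TensorAlgebra.

(* The library's algType excludes the zero ring, which a presentation does not *)
(* do a priori; so the product m and the unit u are separate arguments here.   *)
Section HopfAlgebra.
Variables (k : fieldType) (H : lmodType k).

Record is_algebra (m : H -> H -> H) (u : H) : Prop := IsAlgebra {
  alg_bilin : bilin m;
  alg_assoc : associative m;
  alg_unitl : left_id u m;
  alg_unitr : right_id u m
}.

Record is_coalgebra
    (Delta : {linear H -> tensor H H}) (eps : {linear H -> k^o}) : Prop :=
  IsCoalgebra {
  coalg_assoc : forall h,
    tassoc (tmap Delta idfun (Delta h)) = tmap idfun Delta (Delta h);
  coalg_unitl : forall h, tlift (fun h1 h2 => eps h1 *: h2) (Delta h) = h;
  coalg_unitr : forall h, tlift (fun h1 h2 => eps h2 *: h1) (Delta h) = h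
}.

Record is_bialgebra (m : H -> H -> H) (u : H)
    (Delta : {linear H -> tensor H H}) (eps : {linear H -> k^o}) : Prop :=
  IsBialgebra {
  bialg_alg : is_algebra m u;
  bialg_coalg : is_coalgebra Delta eps;
  bialg_Delta_mul : forall h h', Delta (m h h') = tmul m (Delta h) (Delta h');
  bialg_Delta_unit : Delta u = u ⊗ u;
  bialg_eps_mul : forall h h', eps (m h h') = (eps h : k) * eps h';
  bialg_eps_unit : eps u = 1
}.

Record is_hopf_algebra (m : H -> H -> H) (u : H)
    (Delta : {linear H -> tensor H H}) (eps : {linear H -> k^o})
    (S : {linear H -> H}) : Prop := IsHopfAlgebra {
  hopf_bialg : is_bialgebra m u Delta eps;
  hopf_antipodel : forall h,
    tlift (fun h1 h2 => m (S h1) h2) (Delta h) = (eps h : k) *: u;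
  hopf_antipoder : forall h,
    tlift (fun h1 h2 => m h1 (S h2)) (Delta h) = (eps h : k) *: u
}.

End HopfAlgebra.

Definition is_basis (k : fieldType) (V : lmodType k) (I : finType)
    (b : I -> V) : Prop :=
  (forall c : I -> k, \sum_i c i *: b i = 0 -> forall i, c i = 0) /\
  (forall v, exists c : I -> k, v = \sum_i c i *: b i).

Section GroupAlgebra.
Variables (k : fieldType) (gT : finGroupType).

Definition grp_alg := {ffun gT -> k^o}.

HB.instance Definition _ := GRing.Lmodule.on grp_alg.

Definition gbasis (g : gT) : grp_alg := [ffun h => (h == g)%:R].

Definition gmul (u v : grp_alg) : grp_alg :=
  [ffun g => \sum_h u h * v (h^-1 * g)%g].

Lemma gmulA : associative gmul.
Proof.
move=> u v w; apply/ffunP => g; rewrite !ffunE.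
under eq_bigr => h _ do rewrite ffunE mulr_sumr.
under [RHS]eq_bigr => h _ do rewrite ffunE mulr_suml.
rewrite [RHS]exchange_big /=; apply: eq_bigr => h _.
rewrite [RHS](reindex_inj (mulgI h)) /=; apply: eq_bigr => l _.
by rewrite mulrA mulKg invMg mulgA.
Qed.

Lemma gmul1l : left_id (gbasis 1) gmul.
Proof.
move=> u; apply/ffunP => g; rewrite ffunE (bigD1 1%g) //= ffunE eqxx mul1r.
rewrite invg1 mul1g big1 ?addr0 // => h /negPf h1.
by rewrite ffunE h1 mul0r.
Qed.

Lemma gmul1r : right_id (gbasis 1) gmul.
Proof.
move=> u; apply/ffunP => g; rewrite ffunE (bigD1 g) //= ffunE mulVg eqxx mulr1.
rewrite big1 ?addr0 // => h hg.
by rewrite ffunE -eq_mulVg1 (negPf hg) mulr0.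
Qed.

Lemma gmulDl : left_distributive gmul +%R.
Proof.
move=> u v w; apply/ffunP => g; rewrite !ffunE -big_split /=.
by apply: eq_bigr => h _; rewrite ffunE mulrDl.
Qed.

Lemma gmulDr : right_distributive gmul +%R.
Proof.
move=> u v w; apply/ffunP => g; rewrite !ffunE -big_split /=.
by apply: eq_bigr => h _; rewrite ffunE mulrDr.
Qed.

Lemma gbasis1_neq0 : gbasis 1 != 0.
Proof.
by apply/eqP => /ffunP/(_ 1%g); rewrite !ffunE eqxx => /eqP; rewrite oner_eq0.
Qed.

HB.instance Definition _ := GRing.Zmodule_isNzRing.Build grp_alg
  gmulA gmul1l gmul1r gmulDl gmulDr gbasis1_neq0.

Lemma grp_alg_scalerAl b (u v : grp_alg) : b *: (u * v) = (b *: u) * v.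
Proof.
apply/ffunP => g; rewrite !ffunE scaler_sumr; apply: eq_bigr => h _.
by rewrite ffunE scalerAl.
Qed.

HB.instance Definition _ := GRing.Lmodule_isLalgebra.Build k grp_alg
  grp_alg_scalerAl.

Lemma grp_alg_scalerAr b (u v : grp_alg) : b *: (u * v) = u * (b *: v).
Proof.
apply/ffunP => g; rewrite !ffunE scaler_sumr; apply: eq_bigr => h _.
by rewrite ffunE scalerAr.
Qed.

HB.instance Definition _ := GRing.Lalgebra_isAlgebra.Build k grp_alg
  grp_alg_scalerAr.

Lemma gbasisM g h : gbasis (g * h) = gbasis g * gbasis h.
Proof.
apply/ffunP => l; rewrite !ffunE (bigD1 g) //= !ffunE eqxx mul1r.
rewrite big1 ?addr0 => [|i /negPf ig]; last by rewrite ffunE ig mul0r.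
by rewrite -[in RHS](inj_eq (mulgI g)) mulKVg.
Qed.

End GroupAlgebra.

(* x lies in the smallest subfield of k. *)
Definition in_prime_field (k : fieldType) (x : k) : Prop :=
  forall K : divringClosed k, x \in K.

(* The tuples F = (G, chi, c, a, (alpha_{-1}, alpha_0)). *)
Record datum (k : fieldType) := Datum {
  dG : finGroupType;
  dchi : dG -> k;
  dc : dG -> k;
  da : dG;
  dalpham1 : k;
  dalpha0 : k;
  da_central : da \in 'Z([set: dG])%g;
  dchi_neq0 : forall g, dchi g != 0;
  dchiM : forall h g, dchi (h * g)%g = dchi h * dchi g;
  dchi_a : dchi da = 1;
  dcM : forall h g, dc (h * g)%g = dchi g * dc h + dc g;
  dc_a : dc da = 0;
  dalpha0_01 : dalpha0 = 0 \/ dalpha0 = 1;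
  dalpham1_0 : dalpha0 = 0 -> dalpham1 = 0
}.

Section HF.
Variables (k : fieldType) (p : nat) (F : datum k).

Local Notation kG := (grp_alg k (dG F)).
Local Notation ge := (@gbasis k (dG F)).

(* The generators are the elements of kG, as Some u, and x, as None. *)
Local Notation free := (free_alg k (option kG)).
Local Notation emb u := (fgen k (Some (u : kG))).
Local Notation X := (fgen k (None : option kG)).

(* The first three families make u |-> emb u an algebra morphism from kG. *)
Inductive HF_rel : free -> Prop :=
| HF_rel_one : HF_rel (emb 1 - 1)
| HF_rel_mul u v : HF_rel (emb (u * v) - emb u * emb v)
| HF_rel_lin b u v : HF_rel (emb (b *: u + v) - (b *: emb u + emb v))
| HF_rel_pow :
    HF_rel (X ^+ p
            - (dalpham1 F *: emb (ge (da F) ^+ p - 1) + dalpha0 F *: X))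
| HF_rel_conj g :
    HF_rel (emb (ge g) * X * emb (ge g^-1%g)
            - (dchi g *: X + dc g *: emb (ge (da F) - 1))).

Definition HF := alg_quot HF_rel.

HB.instance Definition _ := GRing.PzRing.on HF.
HB.instance Definition _ := GRing.Lmodule.on HF.

Definition HFg (g : dG F) : HF := aproj HF_rel (emb (ge g)).
Definition HFx : HF := aproj HF_rel X.

Lemma HF_is_algebra : is_algebra ( *%R : HF -> HF -> HF) 1.
Proof.
split; [split=> u b v w | exact: mulrA | exact: mul1r | exact: mulr1].
  by rewrite mulrDl -aquot_scalerAl.
by rewrite mulrDr -aquot_scalerAr.
Qed.

End HF.

(* Main.v *)
Require Import Defs.
From HB Require Import structures.
From mathcomp Require Import all_boot all_order all_fingroup all_algebra.
From mathcomp Require Import all_solvable.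
From mathcomp Require Import generic_quotient boolp finmap monalg ring.

Set Implicit Arguments.
Unset Strict Implicit.
Unset Printing Implicit Defensive.

Import GRing.Theory.
Local Open Scope ring_scope.

(** An algebra morphism from H_F to an algebra A amounts to a group morphism rho
    from G to the units of A and an element x of A subject to the conjugation
    relations and to the power relation
      x^p = alpha_{-1} (rho a ^ p - 1) + alpha_0 x
    (the record [realizes] and the universal property [HF_lift]). The whole
    proof consists in exhibiting the right realizations.

    The compatibility conditions on F enter through a single computation.
    Suppose that x satisfies the power relation and commutes with rho a, and
    put y = chi(g) x + c(g) (rho a - 1), the would-be conjugate of x by g. As
    taking p-th powers is additive on commuting elements in characteristic p,
      y^p = chi(g)^p x^p + c(g)^p (rho a ^ p - 1),
    and y satisfies the power relation again because of an identity in kG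
    between a^p - 1 and a - 1, which is what the conditions on F provide
    ([pow_rel_kG], [pow_rel]).

    Basis. The monomials g x^i with i < p span since their span contains 1 and
    is stable under left multiplication by G and by x: the conjugation relation
    moves x past g, and the power relation lowers x^p. For independence, H_F is
    made to act on the space V with basis e(h, i), h in G, i < p, as left
    multiplication should act on the monomials h x^i. There G acts by left
    translation. A shift operator T, playing the part of right multiplication
    by x, sends e(h, i) to e(h, i + 1), wrapping around at i = p - 1 by the
    power relation; T commutes with G and satisfies the power relation. Since
    x h = h (h^-1 x h), the generator x acts on the vectors e(h, i) with given
    h as Y(h^-1), where Y(g) = chi(g) T + c(g) (a - 1); its p-th power is then
    computed block by block by [pow_rel]. The monomial g x^i sends e(1, 0) to
    e(g, i), whence independence.

    Hopf structure. Delta, eps and S come from realizations in the tensor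
    square, in k and in the opposite algebra of H_F, all of which make sense
    for an arbitrary realization ([Delta_realizes], [counit_realizes],
    [antipode_realizes]). Coassociativity and the counit laws are equalities
    between algebra morphisms, hence may be checked on the generators; the
    antipode laws hold on a set of elements which is stable under left
    multiplication by the generators ([convl_mul], [convr_mul]). *)

(** * Algebras and powers in positive characteristic *)

Section LinearMaps.
Variable k : fieldType.

Lemma linear_id (U : lmodType k) : linear (fun u : U => u).
Proof. by []. Qed.

Lemma linear_atB (U V : lmodType k) (f : U -> V) u v :
  linear f -> f (u - v) = f u - f v.
Proof.
move=> fL; rewrite (linear_atD fL) -[- v]scaleN1r (linear_atZ fL).
by rewrite scaleN1r.
Qed.

Lemma linear_comp (U V W : lmodType k) (f : U -> V) (g : V -> W) :
  linear f -> linear g -> linear (fun u => g (f u)).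
Proof. by move=> fL gL b u v; rewrite fL gL. Qed.

Lemma alg_mul_linearl (A : algType k) (y : A) : linear (fun x => x * y).
Proof. by move=> b x x'; rewrite mulrDl -scalerAl. Qed.

Lemma alg_mul_linearr (A : algType k) (y : A) : linear (fun x => y * x).
Proof. by move=> b x x'; rewrite mulrDr -scalerAr. Qed.

End LinearMaps.

Section Algebras.
Variable k : fieldType.

(** Algebras are triples (A, m, u) satisfying [is_algebra], so that the same
    space may carry several products, such as a product and its opposite. *)
Record is_alg_hom (A B : lmodType k) (mA : A -> A -> A) (uA : A)
    (mB : B -> B -> B) (uB : B) (f : A -> B) : Prop := IsAlgHom {
  hom_linear : linear f;
  hom_mul : forall x y, f (mA x y) = mB (f x) (f y);
  hom_unit : f uA = uB
}.

Lemma alg_hom_comp (A B C : lmodType k) mA (uA : A) mB (uB : B) mC (uC : C)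
    (f : A -> B) (g : B -> C) :
  is_alg_hom mA uA mB uB f -> is_alg_hom mB uB mC uC g ->
  is_alg_hom mA uA mC uC (fun x => g (f x)).
Proof.
move=> [fL fM f1] [gL gM g1]; split=> [b x y | x y | ].
- by rewrite fL gL.
- by rewrite fM gM.
- by rewrite f1 g1.
Qed.

Section AlgRing.
Variables (A : lmodType k) (m : A -> A -> A) (u : A).

Definition mexp (x : A) n : A := iter n (m x) u.

Hypothesis alg_A : is_algebra m u.

(** The space A seen as a ring through m and u, which gives access to the
    theory of powers in rings. *)
Definition alg_ring of is_algebra m u : Type := A.
Local Notation R := (alg_ring alg_A).
HB.instance Definition _ := GRing.Lmodule.on R.

Lemma alg_mulDl : left_distributive m +%R.
Proof. by move=> x y z; rewrite (linear_atD ((alg_bilin alg_A).1 z)). Qed.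
Lemma alg_mulDr : right_distributive m +%R.
Proof. by move=> x y z; rewrite (linear_atD ((alg_bilin alg_A).2 x)). Qed.
Lemma alg_scalel b x y : m (b *: x) y = b *: m x y.
Proof. exact: (linear_atZ ((alg_bilin alg_A).1 y)). Qed.
Lemma alg_scaler b x y : m x (b *: y) = b *: m x y.
Proof. exact: (linear_atZ ((alg_bilin alg_A).2 x)). Qed.
Lemma alg_mulNr x y : m x (- y) = - m x y.
Proof. by rewrite -scaleN1r alg_scaler scaleN1r. Qed.
Lemma alg_mulNl x y : m (- x) y = - m x y.
Proof. by rewrite -scaleN1r alg_scalel scaleN1r. Qed.
Lemma alg_mul0r x : m x 0 = 0.
Proof. exact: (linear_at0 ((alg_bilin alg_A).2 x)). Qed.
Lemma alg_mul0l x : m 0 x = 0.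
Proof. exact: (linear_at0 ((alg_bilin alg_A).1 x)). Qed.

HB.instance Definition _ := GRing.Zmodule_isPzRing.Build R
  (alg_assoc alg_A) (alg_unitl alg_A) (alg_unitr alg_A) alg_mulDl alg_mulDr.

Lemma alg_ring_expE (x : A) n : mexp x n = (x : R) ^+ n.
Proof. by elim: n => // n IHn; rewrite exprS -IHn. Qed.

(** The middle binomial coefficients of (x + y)^p vanish in k. *)
Lemma mexpD_pchar p (x y : A) : p \in [pchar k] -> m x y = m y x ->
  mexp (x + y) p = mexp x p + mexp y p.
Proof.
move=> char_k xy; have p_pr := pcharf_prime char_k.
rewrite !alg_ring_expE (@exprDn_comm R x y p xy).
case: p => // q in char_k p_pr *.
rewrite big_ord_recl big_ord_recr /= subn0 subnn bin0 binn !mulr1n mulr1 mul1r.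
rewrite big1 ?add0r // => i _.
have q_bin : 'C(q.+1, bump 0 i)%:R = 0 :> k.
  apply/eqP; rewrite -(dvdn_pcharf char_k) prime_dvd_bin //.
  by rewrite /bump /= ltnS ltn_ord.
by rewrite -scaler_nat q_bin scale0r.
Qed.

Lemma mexp1 n : mexp u n = u.
Proof. by elim: n => //= n ->; rewrite (alg_unitl alg_A). Qed.

Lemma mexpZ b x n : mexp (b *: x) n = b ^+ n *: mexp x n.
Proof.
elim: n => [|n IHn]; first by rewrite scale1r.
by rewrite /= -/(mexp x n) -/(mexp _ n) IHn alg_scalel alg_scaler scalerA exprS.
Qed.

Lemma mexp_comm x y n : m x y = m y x -> m x (mexp y n) = m (mexp y n) x.
Proof. by rewrite alg_ring_expE; apply: (@commrX R x y n). Qed.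

Lemma mexpSr x n : mexp x n.+1 = m (mexp x n) x.
Proof. exact: mexp_comm. Qed.

Lemma mexpM_comm x y n : m x y = m y x ->
  mexp (m x y) n = m (mexp x n) (mexp y n).
Proof. by rewrite !alg_ring_expE; apply: (@exprMn_comm R x y n). Qed.

Lemma mexpN_pchar p (x : A) : p \in [pchar k] -> mexp (- x) p = - mexp x p.
Proof.
move=> char_k; rewrite -scaleN1r mexpZ -[X in X *: _](pFrobenius_autE char_k).
by rewrite pFrobenius_autN pFrobenius_aut1 scaleN1r.
Qed.

(** Additivity of p-th powers on the commuting elements x, y and u. *)
Lemma mexp_affine_pchar p (b c : k) (x y : A) :
  p \in [pchar k] -> m x y = m y x ->
  mexp (b *: x + c *: (y - u)) p =
  b ^+ p *: mexp x p + c ^+ p *: (mexp y p - u).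
Proof.
move=> char_k xy.
have comm1 z : m z (- u) = m (- u) z.
  by rewrite alg_mulNr alg_mulNl (alg_unitl alg_A) (alg_unitr alg_A).
rewrite mexpD_pchar //; last first.
  rewrite !(alg_scalel, alg_scaler) scalerA mulrC -scalerA.
  by rewrite alg_mulDr alg_mulDl xy comm1.
by rewrite !mexpZ mexpD_pchar // mexpN_pchar // mexp1.
Qed.

End AlgRing.

Lemma opp_is_algebra (A : lmodType k) (m : A -> A -> A) u :
  is_algebra m u -> is_algebra (fun x y => m y x) u.
Proof.
by case=> -[mL mR] mA m1 m2; split.
Qed.

Lemma scalars_is_algebra : is_algebra (fun x y : k^o => (x : k) * y) (1 : k).
Proof.
split; [split=> u b v w | exact: mulrA | exact: mul1r | exact: mulr1].
  by rewrite mulrDl -mulrA.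
by rewrite mulrDr mulrCA.
Qed.

End Algebras.

(** The fixed points of the Frobenius map form a subfield. *)
Lemma in_prime_field_expp (k : fieldType) (p : nat) (x : k) :
  p \in [pchar k] -> in_prime_field x -> x ^+ p = x.
Proof.
move=> char_k; pose P : {pred k} := fun y => y ^+ p == y.
have fixedE y : (y \in P) = (y ^+ p == y) by [].
have P_closed : divring_closed P.
  split=> [|y z|y z]; rewrite !fixedE ?expr1n // => /eqP yp /eqP zp.
    rewrite -(pFrobenius_autE char_k) (pFrobenius_autB_comm _ (mulrC _ _)).
    by rewrite !pFrobenius_autE yp zp.
  by rewrite exprMn exprVn yp zp.
pose D := GRing.isDivringClosed.Build k P P_closed.
pose K : divringClosed k := HB.pack P D.
by move/(_ K); rewrite -[x \in K]/(x ^+ p == x) => /eqP.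
Qed.

(** * Tensor products of algebras *)

Section TensorAlgebras.
Variables (k : fieldType) (A B : lmodType k).
Variables (mA : A -> A -> A) (uA : A) (mB : B -> B -> B) (uB : B).

(** The product of A ⊗ B for two different algebras, needed to compare
    morphisms into H ⊗ (H ⊗ H); for B = A it is [tmul] by definition. *)
Definition tens_mul (s t : tensor A B) : tensor A B :=
  tlift (fun a b => tlift (fun a' b' => mA a a' ⊗ mB b b') t) s.

Hypotheses (alg_A : is_algebra mA uA) (alg_B : is_algebra mB uB).

Let bilA := alg_bilin alg_A.
Let bilB := alg_bilin alg_B.

Let mul_bilinr a b : bilin (fun a' b' => mA a a' ⊗ mB b b').
Proof.
by split=> x c y z /=; rewrite (bilA.2, bilB.2) (tens_linearl, tens_linearr).
Qed.

Let mul_bilinl t : bilin (fun a b => tlift (fun a' b' => mA a a' ⊗ mB b b') t).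
Proof.
have L a b := tlift_is_linear (mul_bilinr a b).
split=> [b | a].
- apply: (tens_family_linear (L^~ b)) => a' b'.
  apply: (@linear_ext _ _ _ (fun a => mA a a' ⊗ mB b b')) => [c x y | a] /=.
    by rewrite bilA.1 tens_linearl.
  exact: (tlift_tens (mul_bilinr a b)).
- apply: (tens_family_linear (L a)) => a' b'.
  apply: (@linear_ext _ _ _ (fun b => mA a a' ⊗ mB b b')) => [c x y | b] /=.
    by rewrite bilB.1 tens_linearr.
  exact: (tlift_tens (mul_bilinr a b)).
Qed.

Lemma tens_mulE a b a' b' : tens_mul (a ⊗ b) (a' ⊗ b') = mA a a' ⊗ mB b b'.
Proof.
by rewrite /tens_mul (tlift_tens (mul_bilinl _)) (tlift_tens (mul_bilinr _ _)).
Qed.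

Lemma tens_mul_bilin : bilin tens_mul.
Proof.
split=> [t | s]; first exact/tlift_is_linear/mul_bilinl.
apply: (tens_family_linear (fun t => tlift_is_linear (mul_bilinl t))).
move=> a b; apply: (linear_ext (tlift_is_linear (mul_bilinr a b))) => t /=.
exact: (tlift_tens (mul_bilinl t)).
Qed.

Lemma tens_is_algebra : is_algebra tens_mul (uA ⊗ uB).
Proof.
have [mulL mulR] := tens_mul_bilin.
split=> [|r s t||]; first exact: tens_mul_bilin.
- apply: (tlift_eq (mulL (tens_mul s t)) (linear_comp (mulL s) (mulL t)) _ r).
  move=> a b /=.
  apply: (tlift_eq (linear_comp (mulL t) (mulR (a ⊗ b)))
                   (linear_comp (mulR (a ⊗ b)) (mulL t)) _ s).
  move=> a' b' /=.
  apply: (tlift_eq (linear_comp (mulR (a' ⊗ b')) (mulR (a ⊗ b)))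
                   (mulR (tens_mul (a ⊗ b) (a' ⊗ b'))) _ t).
  by move=> a'' b'' /=; rewrite !tens_mulE (alg_assoc alg_A) (alg_assoc alg_B).
- move=> t; apply: (tlift_eq (mulR (uA ⊗ uB)) (@linear_id k (tensor A B)) _ t).
  move=> a b /=.
  by rewrite tens_mulE (alg_unitl alg_A) (alg_unitl alg_B).
- move=> t; apply: (tlift_eq (mulL (uA ⊗ uB)) (@linear_id k (tensor A B)) _ t).
  move=> a b /=.
  by rewrite tens_mulE (alg_unitr alg_A) (alg_unitr alg_B).
Qed.

Lemma tens_mexp a b n :
  mexp tens_mul (uA ⊗ uB) (a ⊗ b) n = mexp mA uA a n ⊗ mexp mB uB b n.
Proof. by elim: n => //= n ->; rewrite tens_mulE. Qed.

(** Both sides of the multiplicativity condition are linear in each of the two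
    tensors, so that pure tensors suffice. *)
Lemma tens_alg_hom (C : lmodType k) (mC : C -> C -> C) (uC : C)
    (f : tensor A B -> C) :
  is_algebra mC uC -> linear f -> f (uA ⊗ uB) = uC ->
  (forall a b a' b',
     f (mA a a' ⊗ mB b b') = mC (f (a ⊗ b)) (f (a' ⊗ b'))) ->
  is_alg_hom tens_mul (uA ⊗ uB) mC uC f.
Proof.
move=> alg_C fL f1 fM; split=> // s t.
have [mulL mulR] := tens_mul_bilin; have [mulCL mulCR] := alg_bilin alg_C.
apply: (tlift_eq (linear_comp (mulL t) fL) (linear_comp fL (mulCL (f t))) _ s).
move=> a b /=.
apply: (tlift_eq (linear_comp (mulR (a ⊗ b)) fL)
                 (linear_comp fL (mulCR (f (a ⊗ b)))) _ t).
by move=> a' b' /=; rewrite tens_mulE fM.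
Qed.

End TensorAlgebras.

Section TensorHoms.
Variable k : fieldType.

Lemma tmap_linear (U U' V V' : lmodType k)
    (f : {linear U -> U'}) (g : {linear V -> V'}) : linear (tmap f g).
Proof.
by apply: tlift_is_linear; split=> w b x y /=;
  rewrite linearP (tens_linearl, tens_linearr).
Qed.

Lemma tassoc_linear (U V W : lmodType k) : linear (@tassoc k U V W).
Proof.
have bil (w' : W) : bilin (fun (u' : U) (v' : V) => u' ⊗ (v' ⊗ w')).
  by split=> x b y z /=; rewrite ?tens_linearl ?tens_linearr.
have L w' := tlift_is_linear (bil w').
apply: tlift_is_linear; split=> [w' | s]; first exact: L.
apply: (tens_family_linear L) => u' v'.
apply: (@linear_ext _ _ _ (fun w' => u' ⊗ (v' ⊗ w'))) => [b x y | w'] /=.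
  by rewrite !tens_linearr.
exact: (tlift_tens (bil w')).
Qed.

Variables (A B C : lmodType k).
Variables (mA : A -> A -> A) (uA : A) (mB : B -> B -> B) (uB : B).
Variables (mC : C -> C -> C) (uC : C).
Hypotheses (alg_A : is_algebra mA uA) (alg_B : is_algebra mB uB).
Hypothesis alg_C : is_algebra mC uC.

Lemma tassoc_alg_hom :
  is_alg_hom (tens_mul (tens_mul mA mB) mC) ((uA ⊗ uB) ⊗ uC)
             (tens_mul mA (tens_mul mB mC)) (uA ⊗ (uB ⊗ uC))
             (@tassoc k A B C).
Proof.
have alg_AB := tens_is_algebra alg_A alg_B.
have alg_BC := tens_is_algebra alg_B alg_C.
have alg_ABC := tens_is_algebra alg_A alg_BC.
apply: tens_alg_hom => //; [exact: tassoc_linear | exact: tassoc_tens |].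
have tL := @tassoc_linear A B C.
have [mulL mulR] := alg_bilin alg_AB; have [mul3L mul3R] := alg_bilin alg_ABC.
move=> s c s' c'.
apply: (tlift_eq (linear_comp (mulL s') (linear_comp (tens_linearl _) tL))
  (linear_comp (linear_comp (tens_linearl _) tL) (mul3L _)) _ s) => a b /=.
apply: (tlift_eq (linear_comp (mulR _) (linear_comp (tens_linearl _) tL))
  (linear_comp (linear_comp (tens_linearl _) tL) (mul3R _)) _ s') => a' b' /=.
transitivity (mA a a' ⊗ (mB b b' ⊗ mC c c')).
  rewrite -(tassoc_tens (mA a a') (mB b b') (mC c c')).
  exact: (congr1 (fun s => tassoc (s ⊗ mC c c'))
                 (tens_mulE alg_A alg_B a b a' b')).
transitivity (tens_mul mA (tens_mul mB mC) (a ⊗ (b ⊗ c)) (a' ⊗ (b' ⊗ c'))).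
  rewrite (tens_mulE alg_A alg_BC a (b ⊗ c) a' (b' ⊗ c')).
  exact: (congr1 (tens (mA a a')) (esym (tens_mulE alg_B alg_C b c b' c'))).
exact: (esym (congr2 (tens_mul mA (tens_mul mB mC))
                     (tassoc_tens a b c) (tassoc_tens a' b' c'))).
Qed.

Variables (D : lmodType k) (mD : D -> D -> D) (uD : D).
Hypothesis alg_D : is_algebra mD uD.

Lemma tmap_alg_hom (f : {linear A -> C}) (g : {linear B -> D}) :
  is_alg_hom mA uA mC uC f -> is_alg_hom mB uB mD uD g ->
  is_alg_hom (tens_mul mA mB) (uA ⊗ uB) (tens_mul mC mD) (uC ⊗ uD) (tmap f g).
Proof.
move=> [_ fM f1] [_ gM g1].
apply: (tens_alg_hom alg_A alg_B (tens_is_algebra alg_C alg_D)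
                     (tmap_linear f g)) => [|a b a' b'].
  by rewrite (tmap_tens f g uA uB) f1 g1.
rewrite (tmap_tens f g (mA a a') (mB b b')) (tmap_tens f g a b).
rewrite (tmap_tens f g a' b').
by rewrite (tens_mulE alg_C alg_D (f a) (g b) (f a') (g b')) fM gM.
Qed.

End TensorHoms.

(** * Algebra morphisms out of free algebras, quotients and group algebras *)

Section FreeAlgebraLift.
Variables (k : fieldType) (I : choiceType).
Variables (A : lmodType k) (m : A -> A -> A) (u : A) (f : I -> A).
Hypothesis alg_A : is_algebra m u.

Definition word_val (w : seq I) : A := foldr (fun i => m (f i)) u w.

Lemma word_val_cat w w' : word_val (w ++ w') = m (word_val w) (word_val w').
Proof.
elim: w => [|i w IHw] /=; first by rewrite (alg_unitl alg_A).
by rewrite IHw (alg_assoc alg_A).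
Qed.

Definition free_lift : free_alg k I -> A :=
  mlift (fun w : {fmonom I} => word_val w).

Lemma free_alg_ind (P : free_alg k I -> Prop) :
  P 0 -> (forall b x y, P x -> P y -> P (b *: x + y)) ->
  (forall w : {fmonom I}, P << w >>) -> forall x, P x.
Proof.
move=> P0 PD Pw x; rewrite (monalgE x); elim/big_ind: _ => // [y z Py Pz|w _].
  by rewrite -[y]scale1r; apply: PD.
have -> : << x@_w *g w >> = x@_w *: << w >> + 0 :> {malg k[{fmonom I}]}.
  by rewrite addr0; apply/malgP => v; rewrite mcoeffZ !mcoeffU mulrnAr mulr1.
exact: PD.
Qed.

Lemma free_alg_ext (f1 f2 : free_alg k I -> A) :
  linear f1 -> linear f2 ->
  (forall w : {fmonom I}, f1 << w >> = f2 << w >>) -> f1 =1 f2.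
Proof.
move=> L1 L2 f12; elim/free_alg_ind => [|b x y hx hy|//].
  by rewrite !linear_at0.
by rewrite L1 L2 hx hy.
Qed.

Lemma free_lift_linear : linear free_lift.
Proof. exact: mlift_is_linear. Qed.

Lemma free_lift_gen i : free_lift (fgen k i) = f i.
Proof. by rewrite /free_lift mliftU fmU /= (alg_unitr alg_A). Qed.

Lemma free_lift_alg_hom : is_alg_hom *%R 1 m u free_lift.
Proof.
have L := free_lift_linear; split=> //; last first.
  by rewrite /free_lift [LHS]mliftU fm1.
have [mL mR] := alg_bilin alg_A.
move=> x y.
apply: (free_alg_ext (linear_comp (@alg_mul_linearl k (free_alg k I) y) L)
                     (linear_comp L (mL (free_lift y))) _ x) => w /=.
apply: (free_alg_ext (linear_comp (@alg_mul_linearr k (free_alg k I) << w >>) L)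
                     (linear_comp L (mR (free_lift << w >>))) _ y) => w' /=.
by rewrite malgM_def fgmulUU mul1r /free_lift !mliftU fmM word_val_cat.
Qed.

End FreeAlgebraLift.

Section QuotientLift.
Variables (k : fieldType) (A : algType k) (S : A -> Prop).
Variables (B : lmodType k) (m : B -> B -> B) (u : B) (f : A -> B).
Hypotheses (alg_B : is_algebra m u) (f_hom : is_alg_hom *%R 1 m u f).
Hypothesis f_rel : forall s, S s -> f s = 0.

Definition quot_lift (q : alg_quot S) : B :=
  f (repr (q : lquot (ideal_gen S))).

(** The kernel of f contains the ideal generated by S, so that the value of f
    at a representative only depends on the class. *)
Lemma quot_lift_proj x : quot_lift (aproj S x) = f x.
Proof.
have fL := hom_linear f_hom.
have f_ideal w : w \in spanp (ideal_gen S) -> f w = 0.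
  move=> /asboolP; elim=> [_ [v [s [v' [Ss ->]]]]||b w1 w2 _ h1 _ h2].
  - by rewrite !(hom_mul f_hom) (f_rel Ss) (alg_mul0r alg_B) (alg_mul0l alg_B).
  - exact: linear_at0 fL.
  - by rewrite fL h1 h2 scaler0 addr0.
apply/eqP; rewrite -subr_eq0 -(linear_atB _ _ fL).
by apply/eqP/f_ideal/aprojP; rewrite /aproj reprK.
Qed.

Lemma quot_lift_alg_hom :
  is_alg_hom (@GRing.mul (alg_quot S)) 1 m u quot_lift.
Proof.
split=> [b q r|q r|].
- have [x ->] := aproj_surj q; have [y ->] := aproj_surj r.
  by rewrite -linearP !quot_lift_proj (hom_linear f_hom).
- have [x ->] := aproj_surj q; have [y ->] := aproj_surj r.
  by rewrite -rmorphM !quot_lift_proj (hom_mul f_hom).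
- by rewrite -(rmorph1 (aproj S)) quot_lift_proj (hom_unit f_hom).
Qed.

End QuotientLift.

Section GroupAlgebraLift.
Variables (k : fieldType) (gT : finGroupType).

Lemma grp_algE (v : grp_alg k gT) : v = \sum_g v g *: gbasis k g.
Proof.
apply/ffunP => h; rewrite sum_ffunE (bigD1 h) //= !ffunE eqxx.
rewrite [_ *: _]mulr1 big1 ?addr0 // => g gh.
by rewrite !ffunE eq_sym (negPf gh) [_ *: _]mulr0.
Qed.

Lemma gbasisX (g : gT) n : gbasis k (g ^+ n)%g = gbasis k g ^+ n.
Proof. by elim: n => // n IHn; rewrite expgS exprS gbasisM IHn. Qed.

Lemma grp_alg_ext (A : lmodType k) (f f' : grp_alg k gT -> A) :
  linear f -> linear f' ->
  (forall g, f (gbasis k g) = f' (gbasis k g)) -> f =1 f'.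
Proof.
move=> fL fL' ff' v; rewrite [v]grp_algE.
elim/big_ind: _ => [|x y hx hy|g _]; first by rewrite !linear_at0.
  by rewrite !linear_atD // hx hy.
by rewrite !linear_atZ // ff'.
Qed.

Variables (A : lmodType k) (rho : gT -> A).

Definition grp_lift (v : grp_alg k gT) : A := \sum_g v g *: rho g.

Lemma grp_lift_linear : linear grp_lift.
Proof.
move=> b v w; rewrite /grp_lift scaler_sumr -big_split; apply: eq_bigr => g _.
by rewrite !ffunE /= scalerA -scalerDl.
Qed.

Lemma grp_lift_gbasis g : grp_lift (gbasis k g) = rho g.
Proof.
rewrite /grp_lift (bigD1 g) //= ffunE eqxx scale1r big1 ?addr0 // => h hg.
by rewrite ffunE (negPf hg) scale0r.
Qed.

Variables (m : A -> A -> A) (u : A).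
Hypothesis alg_A : is_algebra m u.
Hypotheses (rho1 : rho 1%g = u).
Hypothesis rhoM : forall g h, rho (g * h)%g = m (rho g) (rho h).

Lemma grp_lift_alg_hom : is_alg_hom *%R 1 m u grp_lift.
Proof.
have [mL mR] := alg_bilin alg_A; have L := grp_lift_linear.
split=> [//|v w|]; last by rewrite grp_lift_gbasis.
apply: (grp_alg_ext (linear_comp (alg_mul_linearl w) L)
                    (linear_comp L (mL (grp_lift w))) _ v) => g /=.
apply: (grp_alg_ext (linear_comp (alg_mul_linearr (gbasis k g)) L)
                    (linear_comp L (mR (grp_lift (gbasis k g)))) _ w) => h /=.
by rewrite -gbasisM !grp_lift_gbasis rhoM.
Qed.

End GroupAlgebraLift.

(** * The universal property of H_F *)

(** What an algebra morphism from H_F to (A, m, u) amounts to: the images of the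
    group elements and of x, subject to the defining relations. *)
Record realizes (k : fieldType) (p : nat) (F : datum k) (A : lmodType k)
    (m : A -> A -> A) (u : A) (rho : dG F -> A) (x : A) : Prop := Realizes {
  realizes1 : rho 1%g = u;
  realizesM : forall g h, rho (g * h)%g = m (rho g) (rho h);
  realizes_pow : mexp m u x p =
    dalpham1 F *: (rho (da F ^+ p)%g - u) + dalpha0 F *: x;
  realizes_conj : forall g, m (m (rho g) x) (rho g^-1%g) =
    dchi g *: x + dc g *: (rho (da F) - u)
}.

Section Presentation.
Variables (k : fieldType) (p : nat) (F : datum k).

Local Notation kG := (grp_alg k (dG F)).
Local Notation H := (HF p F).
Local Notation emb v := (fgen k (Some (v : kG))).
Local Notation X := (fgen k (None : option kG)).
Local Notation proj := (aproj (@HF_rel k p F)).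

Lemma HF_rel_eq v w : HF_rel p (v - w) -> proj v = proj w.
Proof.
move=> vw; apply/aprojP/asboolP/span_gen; exists 1, (v - w), 1; split=> //.
by rewrite mulr1 mul1r.
Qed.

Lemma proj_emb1 : proj (emb 1) = 1.
Proof. by rewrite (HF_rel_eq (HF_rel_one p F)) rmorph1. Qed.

Lemma proj_embM v w : proj (emb (v * w)) = proj (emb v) * proj (emb w).
Proof. by rewrite (HF_rel_eq (HF_rel_mul p v w)) rmorphM. Qed.

Lemma proj_emb_linear : linear (fun v => proj (emb v)).
Proof. by move=> b v w; rewrite (HF_rel_eq (HF_rel_lin p b v w)) linearP. Qed.

Lemma proj_embE v : proj (emb v) = \sum_g (v g : k) *: HFg p g.
Proof.
apply: (grp_alg_ext proj_emb_linear (grp_lift_linear _)) => g.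
by rewrite grp_lift_gbasis.
Qed.

Lemma mexpE (x : H) n : mexp (@GRing.mul H) 1 x n = x ^+ n.
Proof. by elim: n => // n IHn; rewrite exprS -IHn. Qed.

Lemma HF_realizes :
  realizes p (@GRing.mul H) 1 (@HFg k p F) (HFx p F).
Proof.
have embB g : proj (emb (gbasis k g - 1)) = HFg p g - 1.
  by rewrite (linear_atB _ _ proj_emb_linear) proj_emb1.
have projL := aproj_is_linear (@HF_rel k p F).
split=> [|g h||g]; first exact: proj_emb1.
- by rewrite /HFg gbasisM proj_embM.
- transitivity (proj (X ^+ p)); first by rewrite mexpE rmorphXn.
  rewrite -embB gbasisX (HF_rel_eq (HF_rel_pow p F)).
  exact: etrans (projL _ _ _) (congr1 (+%R _) (linear_atZ projL _ _)).
- transitivity (proj (emb (gbasis k g) * X * emb (gbasis k g^-1%g))).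
    by rewrite !rmorphM.
  rewrite -embB (HF_rel_eq (HF_rel_conj p g)).
  exact: etrans (projL _ _ _) (congr1 (+%R _) (linear_atZ projL _ _)).
Qed.

(** Left multiplication by group elements and x, and linear combinations,
    produce all of H_F from 1: a generator taken from kG is a linear combination
    of group elements. *)
Lemma HF_ind (P : H -> Prop) :
  P 1 -> (forall b u v, P u -> P v -> P (b *: u + v)) ->
  (forall g u, P u -> P (HFg p g * u)) -> (forall u, P u -> P (HFx p F * u)) ->
  forall u, P u.
Proof.
move=> P1 PD Pg Px u; have [w ->] := aproj_surj u.
have P0 : P 0 by rewrite -(addNr 1) -scaleN1r; apply: PD.
elim/free_alg_ind: w => [|b x y hx hy|[w]]; first by rewrite raddf0.
  by rewrite linearP; apply: PD.
elim: w => [|i w IHw].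
  suff -> : << FMonom [::] >> = 1 :> free_alg k (option kG) by rewrite rmorph1.
  by congr << _ >>; apply/eqP; rewrite fmP fm1.
have -> : << FMonom (i :: w) >> =
    fgen k i * << FMonom w >> :> free_alg k (option kG).
  rewrite malgM_def fgmulUU mulr1.
  by congr << _ >>; apply/eqP; rewrite fmP fmM fmU.
rewrite rmorphM /=; set u' := proj _ in IHw *; case: i => [v|]; last exact: Px.
rewrite proj_embE; elim/big_rec: _ => [|g x _ Px']; first by rewrite mul0r.
have -> : ((v g : k) *: HFg p g + x) * u' = (v g : k) *: (HFg p g * u') + x * u'.
  exact: ((alg_bilin (HF_is_algebra p F)).1 u').
exact: PD (Pg g u' IHw) Px'.
Qed.

Section Lift.
Variables (A : lmodType k) (m : A -> A -> A) (e : A) (rho : dG F -> A) (x : A).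
Hypotheses (alg_A : is_algebra m e) (real : realizes p m e rho x).

(** Universal property of H_F: a realization sends each relator to 0. *)
Theorem HF_lift : exists Phi : {linear H -> A},
  [/\ is_alg_hom (@GRing.mul H) 1 m e Phi,
      forall g, Phi (HFg p g) = rho g & Phi (HFx p F) = x].
Proof.
pose f i := if i is Some v then grp_lift rho v else x.
pose fh := free_lift_alg_hom f alg_A; pose fL := hom_linear fh.
have fg i : free_lift m e f (fgen k i) = f i by apply: free_lift_gen.
have [rhoL rhoM rho1] :=
  grp_lift_alg_hom alg_A (realizes1 real) (realizesM real).
have fX y n : free_lift m e f (y ^+ n) = mexp m e (free_lift m e f y) n.
  elim: n => [|n IHn]; first exact: hom_unit fh.
  by rewrite exprS (hom_mul fh) IHn.
have fB y z : free_lift m e f (y - z) = free_lift m e f y - free_lift m e f z.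
  exact: linear_atB.
have rhoB g : grp_lift rho (gbasis k g - 1) = rho g - e.
  by rewrite (linear_atB _ _ rhoL) rho1 grp_lift_gbasis.
have f_rel s : HF_rel p s -> free_lift m e f s = 0.
  case=> [|v w|b v w||g]; rewrite fB; apply/eqP; rewrite subr_eq0; apply/eqP.
  - by rewrite fg (hom_unit fh).
  - by rewrite (hom_mul fh) !fg /= rhoM.
  - by rewrite fL !fg /= rhoL.
  - rewrite fX fL (linear_atZ fL) !fg /= (realizes_pow real).
    by rewrite -gbasisX rhoB.
  - rewrite !(hom_mul fh) fL (linear_atZ fL) !fg /= !grp_lift_gbasis.
    by rewrite (realizes_conj real) rhoB.
have Ph := quot_lift_alg_hom alg_A fh f_rel.
pose PhL := GRing.isLinear.Build k H A *:%R
  (quot_lift (free_lift m e f) : H -> A) (hom_linear Ph).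
pose Phi : {linear H -> A} := HB.pack (quot_lift (free_lift m e f) : H -> A) PhL.
exists Phi; split=> // [g|];
  rewrite /= [LHS](quot_lift_proj alg_A fh f_rel) fg //.
by rewrite /= grp_lift_gbasis.
Qed.

End Lift.

End Presentation.

(** * Hopf algebra axioms checked on generators *)

(** An algebra generated by group-like elements [rho g] and an element [x] such
    that Delta x = x ⊗ rho a + 1 ⊗ x, in which [gen_ind] expresses generation. The
    Hopf algebra axioms only have to be checked on generators. *)
Section HopfFromGenerators.
Variables (k : fieldType) (G : finGroupType) (H : lmodType k).
Variables (m : H -> H -> H) (u : H) (rho : G -> H) (a : G) (x : H).
Hypothesis alg_H : is_algebra m u.
Hypotheses (rho1 : rho 1%g = u)
  (rhoM : forall g h, rho (g * h)%g = m (rho g) (rho h)).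
Hypothesis gen_ind : forall P : H -> Prop,
  P u -> (forall b v w, P v -> P w -> P (b *: v + w)) ->
  (forall g v, P v -> P (m (rho g) v)) -> (forall v, P v -> P (m x v)) ->
  forall v, P v.

Variables (Delta : {linear H -> tensor H H}) (eps : {linear H -> k^o}).
Variable S : {linear H -> H}.
Local Notation mT := (tens_mul m m).
Hypotheses (DeltaH : is_alg_hom m u mT (u ⊗ u) Delta)
  (Delta_rho : forall g, Delta (rho g) = rho g ⊗ rho g)
  (Delta_x : Delta x = x ⊗ rho a + u ⊗ x).
Hypotheses
  (epsH : is_alg_hom m u (fun b c : k^o => (b : k) * c) (1 : k) eps)
  (eps_rho : forall g, eps (rho g) = 1) (eps_x : eps x = 0).
Hypotheses (SH : is_alg_hom m u (fun v w => m w v) u S)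
  (S_rho : forall g, S (rho g) = rho g^-1%g)
  (S_x : S x = m (- x) (rho a^-1%g)).

Let algT : is_algebra mT (u ⊗ u) := tens_is_algebra alg_H alg_H.
Let idH : is_alg_hom m u m u (idfun : {linear H -> H}).
Proof. by split=> // b v w; rewrite linearP. Qed.

Lemma gen_hom_ext (A : lmodType k) (mA : A -> A -> A) (uA : A) (f f' : H -> A) :
  is_alg_hom m u mA uA f -> is_alg_hom m u mA uA f' ->
  (forall g, f (rho g) = f' (rho g)) -> f x = f' x -> f =1 f'.
Proof.
move=> [fL fM f1] [fL' fM' f1'] ffg ffx.
elim/gen_ind => [|b v w hv hw|g v hv|v hv].
- by rewrite f1 f1'.
- by rewrite fL fL' hv hw.
- by rewrite fM fM' ffg hv.
- by rewrite fM fM' ffx hv.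
Qed.

Lemma gen_coassoc v :
  tassoc (tmap Delta idfun (Delta v)) = tmap idfun Delta (Delta v).
Proof.
have tDi := tmap_alg_hom alg_H alg_H algT alg_H DeltaH idH.
have tiD := tmap_alg_hom alg_H alg_H alg_H algT idH DeltaH.
have tA := tassoc_alg_hom alg_H alg_H alg_H.
apply: (gen_hom_ext (alg_hom_comp DeltaH (alg_hom_comp tDi tA))
                    (alg_hom_comp DeltaH tiD)) => [g|].
  rewrite Delta_rho (tmap_tens Delta idfun) (tmap_tens idfun Delta) /=.
  by rewrite Delta_rho tassoc_tens.
rewrite Delta_x (linear_atD (hom_linear tDi)) (linear_atD (hom_linear tiD)).
rewrite !(tmap_tens Delta idfun) !(tmap_tens idfun Delta) /=.
rewrite Delta_x Delta_rho (hom_unit DeltaH).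
rewrite (linear_atD (tens_linearl _)) (linear_atD (tens_linearr _)).
have tAD s t := linear_atD (hom_linear tA) s t.
apply: etrans (tAD ((x ⊗ rho a) ⊗ rho a + (u ⊗ x) ⊗ rho a) ((u ⊗ u) ⊗ x)) _.
apply: etrans (congr1 (+%R^~ _) (tAD ((x ⊗ rho a) ⊗ rho a) _)) _.
apply: etrans (esym (addrA _ _ _)).
exact: (congr2 +%R (congr2 +%R (tassoc_tens x (rho a) (rho a))
                                 (tassoc_tens u x (rho a)))
                   (tassoc_tens u u x)).
Qed.

Let counitl_bilin : bilin (fun v w : H => (eps v : k) *: w).
Proof.
split=> [w b v v'|v b w w'] /=.
  by rewrite linearP scalerDl scalerA.
by rewrite scalerDr !scalerA mulrC.
Qed.

Let counitr_bilin : bilin (fun v w : H => (eps w : k) *: v).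
Proof. by split=> [w|v]; [apply: counitl_bilin.2 | apply: counitl_bilin.1]. Qed.

Lemma gen_counitl v : tlift (fun v w => eps v *: w) (Delta v) = v.
Proof.
have hom : is_alg_hom mT (u ⊗ u) m u (tlift (fun v w : H => (eps v : k) *: w)).
  apply: (tens_alg_hom alg_H alg_H alg_H (tlift_is_linear counitl_bilin)).
    by rewrite (tlift_tens counitl_bilin) (hom_unit epsH) scale1r.
  move=> b c b' c'; rewrite !(tlift_tens counitl_bilin) (hom_mul epsH).
  by rewrite (alg_scalel alg_H) (alg_scaler alg_H) scalerA.
apply: (gen_hom_ext (alg_hom_comp DeltaH hom) idH) => [g|].
  by rewrite Delta_rho (tlift_tens counitl_bilin) eps_rho scale1r.
rewrite Delta_x (linear_atD (hom_linear hom)) !(tlift_tens counitl_bilin).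
by rewrite eps_x (hom_unit epsH) scale0r scale1r add0r.
Qed.

Lemma gen_counitr v : tlift (fun v w => eps w *: v) (Delta v) = v.
Proof.
have hom : is_alg_hom mT (u ⊗ u) m u (tlift (fun v w : H => (eps w : k) *: v)).
  apply: (tens_alg_hom alg_H alg_H alg_H (tlift_is_linear counitr_bilin)).
    by rewrite (tlift_tens counitr_bilin) (hom_unit epsH) scale1r.
  move=> b c b' c'; rewrite !(tlift_tens counitr_bilin) (hom_mul epsH).
  by rewrite (alg_scalel alg_H) (alg_scaler alg_H) scalerA.
apply: (gen_hom_ext (alg_hom_comp DeltaH hom) idH) => [g|].
  by rewrite Delta_rho (tlift_tens counitr_bilin) eps_rho scale1r.
rewrite Delta_x (linear_atD (hom_linear hom)) !(tlift_tens counitr_bilin).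
by rewrite eps_x eps_rho scale0r scale1r addr0.
Qed.

Let mulL := (alg_bilin alg_H).1.
Let mulR := (alg_bilin alg_H).2.
Let mulTL := (alg_bilin algT).1.
Let mulTR := (alg_bilin algT).2.

Let antil_bilin : bilin (fun v w => m (S v) w).
Proof.
split=> [w|v]; last exact: mulR.
exact: linear_comp (hom_linear SH) (mulL w).
Qed.

Let antir_bilin : bilin (fun v w => m v (S w)).
Proof.
split=> [w|v]; first exact: mulL.
exact: linear_comp (hom_linear SH) (mulR v).
Qed.

Local Notation convl := (tlift (fun v w => m (S v) w)).
Local Notation convr := (tlift (fun v w => m v (S w))).

(** With s and t the coproducts of v and w this reads
      sum S(v1 w1) v2 w2 = sum S(w1) (sum S(v1) v2) w2 = b sum S(w1) w2
    whenever v satisfies the left antipode law sum S(v1) v2 = b. *)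
Lemma convl_mul s t b : convl s = b *: u -> convl (mT s t) = b *: convl t.
Proof.
have cL := tlift_is_linear antil_bilin => sb.
have scaleL : linear (fun v : H => b *: v).
  by move=> c v w; rewrite scalerDr !scalerA mulrC.
apply: (tlift_eq (linear_comp (mulTR s) cL) (linear_comp cL scaleL) _ t).
move=> c d /=; transitivity (m (S c) (m (convl s) d)).
  apply: (tlift_eq (linear_comp (mulTL (c ⊗ d)) cL)
           (linear_comp cL (linear_comp (mulL d) (mulR (S c)))) _ s) => v w /=.
  rewrite (tens_mulE alg_H alg_H) !(tlift_tens antil_bilin) (hom_mul SH).
  by rewrite !(alg_assoc alg_H).
rewrite sb (alg_scalel alg_H) (alg_unitl alg_H) (alg_scaler alg_H).
by rewrite (tlift_tens antil_bilin).
Qed.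

(** Mirror image of [convl_mul]; here the inner sum comes from w. *)
Lemma convr_mul s t b : convr t = b *: u -> convr (mT s t) = b *: convr s.
Proof.
have cL := tlift_is_linear antir_bilin => tb.
have scaleL : linear (fun v : H => b *: v).
  by move=> c v w; rewrite scalerDr !scalerA mulrC.
apply: (tlift_eq (linear_comp (mulTL t) cL) (linear_comp cL scaleL) _ s).
move=> c d /=; transitivity (m c (m (convr t) (S d))).
  apply: (tlift_eq (linear_comp (mulTR (c ⊗ d)) cL)
           (linear_comp cL (linear_comp (mulL (S d)) (mulR c))) _ t) => v w /=.
  rewrite (tens_mulE alg_H alg_H) !(tlift_tens antir_bilin) (hom_mul SH).
  by rewrite !(alg_assoc alg_H).
rewrite tb (alg_scalel alg_H) (alg_unitl alg_H) (alg_scaler alg_H).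
by rewrite (tlift_tens antir_bilin).
Qed.

(** The generators satisfy the left antipode law by direct computation, and
    [convl_mul] carries the law from v to g v and to x v. *)
Lemma gen_antipodel v : convl (Delta v) = (eps v : k) *: u.
Proof.
have cL := tlift_is_linear antil_bilin.
have c_rho g : convl (Delta (rho g)) = (1 : k) *: u.
  by rewrite Delta_rho (tlift_tens antil_bilin) S_rho -rhoM mulVg rho1 scale1r.
have c_x : convl (Delta x) = (0 : k) *: u.
  rewrite Delta_x (linear_atD cL) !(tlift_tens antil_bilin) S_x (hom_unit SH).
  rewrite -(alg_assoc alg_H) -rhoM mulVg rho1 (alg_unitl alg_H).
  by rewrite (alg_unitr alg_H) addNr scale0r.
elim/gen_ind: v => [|b v w hv hw|g v hv|v hv].
- by rewrite -rho1 c_rho eps_rho rho1.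
- by rewrite !linearP /= (linear_atD cL) (linear_atZ cL) hv hw scalerDl scalerA.
- rewrite (hom_mul DeltaH) (convl_mul _ (c_rho g)) hv.
  by rewrite (hom_mul epsH) eps_rho mul1r scale1r.
- rewrite (hom_mul DeltaH) (convl_mul _ c_x).
  by rewrite (hom_mul epsH) eps_x mul0r !scale0r.
Qed.

Lemma gen_antipoder v : convr (Delta v) = (eps v : k) *: u.
Proof.
have cL := tlift_is_linear antir_bilin.
have c_rho g : convr (Delta (rho g)) = u.
  by rewrite Delta_rho (tlift_tens antir_bilin) S_rho -rhoM mulgV rho1.
have c_x : convr (Delta x) = 0.
  rewrite Delta_x (linear_atD cL) !(tlift_tens antir_bilin) S_x S_rho.
  by rewrite (alg_unitl alg_H) (alg_mulNl alg_H) subrr.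
elim/gen_ind: v => [|b v w hv hw|g v hv|v hv].
- by rewrite -rho1 c_rho eps_rho rho1 scale1r.
- by rewrite !linearP /= (linear_atD cL) (linear_atZ cL) hv hw scalerDl scalerA.
- rewrite (hom_mul DeltaH) (convr_mul _ hv) c_rho.
  by rewrite (hom_mul epsH) eps_rho mul1r.
- rewrite (hom_mul DeltaH) (convr_mul _ hv) c_x.
  by rewrite (hom_mul epsH) eps_x mul0r scale0r scaler0.
Qed.

Theorem gen_hopf : is_hopf_algebra m u Delta eps S.
Proof.
split; [split | exact: gen_antipodel | exact: gen_antipoder].
- exact: alg_H.
- by split; [exact: gen_coassoc | exact: gen_counitl | exact: gen_counitr].
- exact: hom_mul DeltaH.
- exact: hom_unit DeltaH.
- exact: hom_mul epsH.
- exact: hom_unit epsH.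
Qed.

End HopfFromGenerators.

(** * The power relation for the conjugates of x *)

Section Compatibility.
Variables (k : fieldType) (p : nat) (F : datum k).
Hypothesis char_k : p \in [pchar k].
Hypothesis cond0 : dalpha0 F = 0 ->
  forall g : dG F, dc g *: (gbasis k (da F) ^+ p - 1) = 0.
Hypothesis cond1 : dalpha0 F = 1 ->
  (da F ^+ p)%g = da F /\
  forall g : dG F,
    (in_prime_field (dchi g) /\ dchi g != 0) /\
    (dalpham1 F * (dchi g - 1) + dc g ^+ p - dc g)
      *: (gbasis k (da F) - 1) = 0.

Local Notation a := (da F).
Local Notation al := (dalpham1 F).
Local Notation al0 := (dalpha0 F).
Local Notation chi := (@dchi k F).
Local Notation cc := (@dc k F).

Lemma dchi1 : chi 1%g = 1.
Proof.
apply: (mulfI (dchi_neq0 (1%g : dG F))).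
by rewrite mulr1 -dchiM mulg1.
Qed.

Lemma dc1 : cc 1%g = 0.
Proof.
have := dcM (1%g : dG F) 1%g; rewrite mulg1 dchi1 mul1r => /eqP.
by rewrite -[X in X == _]addr0 (inj_eq (addrI _)) eq_sym => /eqP.
Qed.

Lemma da_comm g : (g * a = a * g)%g.
Proof. by have /centerP [_ ->] := da_central F; rewrite ?inE. Qed.

Lemma daX_comm n g : (g * a ^+ n = a ^+ n * g)%g.
Proof. exact/commuteX/da_comm. Qed.

Lemma dchiX n : chi (a ^+ n)%g = 1.
Proof.
elim: n => [|n IHn]; first exact: dchi1.
by rewrite expgS dchiM dchi_a IHn mulr1.
Qed.

Lemma dcX n : cc (a ^+ n)%g = 0.
Proof.
elim: n => [|n IHn]; first exact: dc1.
by rewrite expgS dcM dc_a IHn mulr0 addr0.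
Qed.

Lemma dchi_aV : chi (a^-1)%g = 1.
Proof. by have := dchiM a a^-1%g; rewrite mulgV dchi1 dchi_a mul1r. Qed.

Lemma dc_aV : cc (a^-1)%g = 0.
Proof. by have := dcM a a^-1%g; rewrite mulgV dc1 dc_a mulr0 add0r. Qed.

(** Wherever alpha_0 appears as a factor, a^p may be replaced by a. *)
Lemma alpha0_aX : al0 = 0 \/ (a ^+ p)%g = a.
Proof. by case: (dalpha0_01 F) => [|/cond1[]]; [left | right]. Qed.

Lemma alpha0_chiX g : chi g ^+ p * al0 = al0 * chi g.
Proof.
case: (dalpha0_01 F) => [->|al01]; first by rewrite mulr0 mul0r.
have [_ /(_ g)[[chi_p _] _]] := cond1 al01.
by rewrite al01 mulr1 mul1r (in_prime_field_expp char_k).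
Qed.

(** The coefficient identity behind [pow_rel], as an equation in kG, where it
    follows from the condition on F attached to the value of alpha_0. *)
Lemma pow_rel_kG g :
  (chi g ^+ p * al + cc g ^+ p - al) *: (gbasis k (a ^+ p)%g - 1) =
  (al0 * cc g) *: (gbasis k a - 1).
Proof.
case: (dalpha0_01 F) => [al00|al01].
  rewrite al00 (dalpham1_0 al00) mulr0 mul0r add0r subr0 scale0r gbasisX.
  have p_gt0 := prime_gt0 (pcharf_prime char_k).
  by rewrite -(prednK p_gt0) exprSr -scalerA (prednK p_gt0) cond0 ?scaler0.
have [aXp /(_ g)[[chi_p _] /eqP]] := cond1 al01.
rewrite aXp al01 mul1r (in_prime_field_expp char_k chi_p) => cg.
move/eqP: cg => cg; apply/eqP; rewrite -subr_eq0 -scalerBl; apply/eqP.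
rewrite -[RHS]cg; congr (_ *: _); ring.
Qed.

(** If x satisfies the power relation then so does its would-be conjugate y. *)
Lemma pow_rel (A : lmodType k) (m : A -> A -> A) (u : A) (rho : dG F -> A) x g :
  is_algebra m u -> rho 1%g = u ->
  (forall g h, rho (g * h)%g = m (rho g) (rho h)) ->
  mexp m u x p = al *: (rho (a ^+ p)%g - u) + al0 *: x ->
  m x (rho a) = m (rho a) x ->
  let y := chi g *: x + cc g *: (rho a - u) in
  mexp m u y p = al *: (rho (a ^+ p)%g - u) + al0 *: y.
Proof.
move=> alg_A rho1 rhoM xp xa y.
have rhoX n : mexp m u (rho a) n = rho (a ^+ n)%g.
  by elim: n => [|n IHn]; rewrite ?rho1 // expgS rhoM -IHn.
have rel : (chi g ^+ p * al + cc g ^+ p - al) *: (rho (a ^+ p)%g - u) =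
    (al0 * cc g) *: (rho a - u).
  have L := @grp_lift_linear k _ A rho.
  have B h : grp_lift rho (gbasis k h - 1) = rho h - u.
    by rewrite (linear_atB _ _ L) -[1]/(gbasis k 1) !grp_lift_gbasis rho1.
  by have /(congr1 (grp_lift rho)) := pow_rel_kG g; rewrite !(linear_atZ L) !B.
rewrite /y (mexp_affine_pchar alg_A) // xp rhoX.
move: rel; move: (rho (a ^+ p)%g - u) (rho a - u) => r s rel.
rewrite !scalerDr !scalerA alpha0_chiX -rel addrAC -scalerDl [RHS]addrCA.
by rewrite -scalerDl addrC [al + _]addrC subrK.
Qed.

(** * A representation with basis G x {0, ..., p-1} *)

Local Notation I := (dG F * 'I_p)%type.
Local Notation V := {ffun I -> k^o}.

(** The basis vectors e(h, i) of the model; with i ranging over natural numbers,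
    e(h, i) is 0 as soon as i >= p. *)
Definition unit_vec (h : dG F) (i : nat) : V :=
  [ffun j => ((j.1 == h) && (val j.2 == i))%:R].

Local Notation e := unit_vec.

Lemma unit_vec_sum_coef (c : I -> k) j : (\sum_i c i *: e i.1 i.2) j = c j.
Proof.
rewrite sum_ffunE (bigD1 j) //= !ffunE !eqxx [_ *: _]mulr1.
rewrite big1 ?addr0 // => [[h i]] ij; rewrite !ffunE /=.
case: eqP => [jh|_]; last exact: mulr0.
case: eqP => [ji|_]; last exact: mulr0.
by case/eqP: ij; case: j jh ji => /= h' i' -> /val_inj ->.
Qed.

Lemma unit_vecE (v : V) : v = \sum_j (v j : k) *: e j.1 j.2.
Proof.
by apply/ffunP => j; rewrite unit_vec_sum_coef.
Qed.

Lemma End_ext (f g : 'End(V)) :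
  (forall h i, (i < p)%N -> f (e h i) = g (e h i)) -> f = g.
Proof.
move=> fg; apply/lfunP => v; rewrite [v]unit_vecE !linear_sum /=.
by apply: eq_bigr => j _; rewrite !linearZ /= fg.
Qed.

Section Operator.
Variable phi : dG F -> nat -> V.

Definition op_fun (v : V) : V := \sum_j (v j : k) *: phi j.1 j.2.

Fact op_fun_linear : linear op_fun.
Proof.
move=> b v w; rewrite /op_fun scaler_sumr -big_split; apply: eq_bigr => j _.
by rewrite !ffunE /= scalerA -scalerDl.
Qed.

HB.instance Definition _ := GRing.isLinear.Build k V V *:%R op_fun op_fun_linear.

Definition op : 'End(V) := linfun op_fun.

Lemma opE h i : (i < p)%N -> op (e h i) = phi h i.
Proof.
move=> lt_ip; rewrite lfunE /= /op_fun (bigD1 (h, Ordinal lt_ip)) //=.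
rewrite ffunE /= !eqxx scale1r big1 ?addr0 // => [[h' i']] ne.
rewrite ffunE /=; case: eqP => [hh|_]; last by rewrite scale0r.
case: eqP => [ii|_]; last by rewrite scale0r.
by case/eqP: ne; rewrite hh; congr (_, _); apply: val_inj.
Qed.

End Operator.

Let p_gt1 : (1 < p)%N. Proof. exact/prime_gt1/(pcharf_prime char_k). Qed.
Let p_gt0 : (0 < p)%N. Proof. exact: ltnW. Qed.

Definition left_op (g : dG F) : 'End(V) := op (fun h i => e (g * h)%g i).

(** Right multiplication by x on the monomials h x^i, where h x^p is rewritten by
    means of the power relation. *)
Definition shift_op : 'End(V) := op (fun h i =>
  if (i.+1 < p)%N then e h i.+1
  else al *: (e (a ^+ p * h)%g 0 - e h 0) + al0 *: e h 1).

Local Notation L := left_op.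
Local Notation T := shift_op.

Lemma left_opE g h i : (i < p)%N -> L g (e h i) = e (g * h)%g i.
Proof. exact: opE. Qed.

Lemma left_op1 : L 1%g = \1%VF.
Proof. by apply: End_ext => h i ip; rewrite left_opE // mul1g id_lfunE. Qed.

Lemma left_opM g h : L (g * h)%g = (L g \o L h)%VF.
Proof.
by apply: End_ext => l i ip; rewrite comp_lfunE !left_opE // mulgA.
Qed.

Lemma shift_op_small h i : (i.+1 < p)%N -> T (e h i) = e h i.+1.
Proof. by move=> ip; rewrite opE ?ip // ltnW. Qed.

Lemma shift_op_last h : T (e h p.-1) =
  al *: (L (a ^+ p)%g (e h 0) - e h 0) + al0 *: T (e h 0).
Proof.
by rewrite opE prednK // ltnn left_opE // shift_op_small.
Qed.

Lemma shift_op_iter h i : (i < p)%N -> iter i T (e h 0) = e h i.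
Proof. by elim: i => //= i IHi ip; rewrite IHi ?shift_op_small // ltnW. Qed.

Lemma op_cases (P : nat -> Prop) :
  (forall i, (i.+1 < p)%N -> P i) -> P p.-1 -> forall i, (i < p)%N -> P i.
Proof.
move=> Psmall Plast i ip; case: (ltnP i.+1 p) => [/Psmall //|pi].
by suff -> : i = p.-1 by []; apply/eqP; rewrite -eqSS prednK // eqn_leq ip.
Qed.

Lemma left_shift_comm g : (L g \o T = T \o L g)%VF.
Proof.
apply: End_ext => h i ip; rewrite !comp_lfunE left_opE //.
move: i ip; apply: op_cases => [i ip|].
  by rewrite !shift_op_small // left_opE.
rewrite !shift_op_last !linearD !linearZ /= linearN /= !shift_op_small //.
by rewrite !left_opE // mulgA daX_comm -mulgA.
Qed.

Local Notation mexpV := (mexp (@comp_lfun k V V V) \1%VF).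

Fact End_is_algebra : is_algebra (@comp_lfun k V V V) \1%VF.
Proof.
split; first split=> [f b g h|f b g h].
- by rewrite comp_lfunDl comp_lfunZl.
- by rewrite comp_lfunDr comp_lfunZr.
- by move=> f g h; rewrite comp_lfunA.
- exact: comp_lfun1l.
- exact: comp_lfun1r.
Qed.
Let algV := End_is_algebra.

Lemma mexpVE f n v : mexpV f n v = iter n f v.
Proof.
elim: n => [|n IHn]; first exact: id_lfunE.
exact: etrans (comp_lfunE _ _ _) (congr1 f IHn).
Qed.

(** The two sides agree on e(h, 0) by construction and commute with T, whose
    powers map e(h, 0) to all the e(h, i). *)
Lemma shift_op_pow :
  mexpV T p = al *: (L (a ^+ p)%g - \1%VF) + al0 *: T.
Proof.
set B := RHS.
have BT : (T \o B = B \o T)%VF.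
  rewrite /B (alg_mulDr algV) (alg_mulDl algV) !(alg_scaler algV).
  rewrite !(alg_scalel algV) (alg_mulDr algV) (alg_mulDl algV).
  rewrite (alg_mulNr algV) (alg_mulNl algV) comp_lfun1l comp_lfun1r.
  by rewrite left_shift_comm.
have B0 h : mexpV T p (e h 0) = B (e h 0).
  have iter_p f (v : V) : iter p f v = f (iter p.-1 f v).
    have iter_n n w : (0 < n)%N -> iter n f w = f (iter n.-1 f w) by case: n.
    exact: iter_n.
  rewrite mexpVE iter_p shift_op_iter ?ltn_predL //.
  by rewrite shift_op_last !(add_lfunE, scale_lfunE, opp_lfunE) id_lfunE.
apply: End_ext => h i ip; rewrite -(shift_op_iter h ip) -!mexpVE.
have powT : (mexpV T p \o T = T \o mexpV T p)%VF.
  exact/esym/(mexp_comm algV).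
rewrite -[LHS]comp_lfunE -[RHS]comp_lfunE.
rewrite (mexp_comm algV i powT) (mexp_comm algV i (esym BT)).
by rewrite !comp_lfunE B0.
Qed.

(** The conjugate of x by g, with T in place of x. *)
Definition conj_op (g : dG F) : 'End(V) :=
  chi g *: T + cc g *: (L a - \1%VF).

Local Notation Y := conj_op.

(** Left multiplication by x: x h x^i = h (h^-1 x h) x^i. On the block of the
    vectors e(h, i) with h fixed it is a polynomial in the commuting operators T
    and L a. *)
Definition x_op : 'End(V) := op (fun h i => Y h^-1%g (e h i)).

Local Notation X := x_op (only parsing).

Lemma x_opE h i : (i < p)%N -> X (e h i) = Y h^-1%g (e h i).
Proof. exact: opE. Qed.

Lemma conj_op_comm (f : 'End(V)) g :
  (f \o T = T \o f)%VF -> (f \o L a = L a \o f)%VF -> (f \o Y g = Y g \o f)%VF.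
Proof.
move=> fT fa; rewrite /Y (alg_mulDr algV) (alg_mulDl algV) !(alg_scaler algV).
rewrite !(alg_scalel algV) (alg_mulDr algV) (alg_mulDl algV).
by rewrite (alg_mulNr algV) (alg_mulNl algV) comp_lfun1l comp_lfun1r fT fa.
Qed.

Lemma left_a_comm g : (L g \o L a = L a \o L g)%VF.
Proof. by rewrite -!left_opM da_comm. Qed.

Lemma comm_at (f g : 'End(V)) v : (f \o g = g \o f)%VF -> f (g v) = g (f v).
Proof. by move=> fg; rewrite -!comp_lfunE fg. Qed.

(** The operators L a and T move e(h, i) to blocks indexed by h times a power
    of a, on which x acts by the same formula. *)
Lemma conj_opV_aX n h : Y (a ^+ n * h)^-1%g = Y h^-1%g.
Proof.
have chi_n : chi (a ^+ n)^-1%g = 1.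
  by have := dchiM (a ^+ n)%g (a ^+ n)^-1%g; rewrite mulgV dchi1 dchiX mul1r.
have c_n : cc (a ^+ n)^-1%g = 0.
  by have := dcM (a ^+ n)%g (a ^+ n)^-1%g; rewrite mulgV dc1 dcX mulr0 add0r.
by rewrite /Y invMg dchiM dcM chi_n c_n mulr1 mul1r addr0.
Qed.

Lemma x_op_left_a : (X \o L a = L a \o X)%VF.
Proof.
apply: End_ext => h i ip; rewrite !comp_lfunE.
have LY : (L a \o Y h^-1%g = Y h^-1%g \o L a)%VF.
  exact/conj_op_comm/left_a_comm/left_shift_comm.
rewrite (left_opE a h ip) (x_opE _ ip) (x_opE h ip) -{1}(expg1 a).
by rewrite conj_opV_aX -(left_opE a h ip) (comm_at _ LY).
Qed.

Lemma End_comb (f g : 'End(V)) (b b' : k) u v w :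
  f u = g u -> f v = g v -> f w = g w ->
  f (b *: (u - v) + b' *: w) = g (b *: (u - v) + b' *: w).
Proof. by move=> fu fv fw; rewrite !linearD !linearZ /= !linearN /= fu fv fw. Qed.

Lemma x_op_shift : (X \o T = T \o X)%VF.
Proof.
apply: End_ext => h i ip; rewrite !comp_lfunE (x_opE h ip).
have LT := left_shift_comm.
have TY : (T \o Y h^-1%g = Y h^-1%g \o T)%VF.
  by apply: conj_op_comm => //; apply/esym.
rewrite (comm_at _ TY); move: i ip; apply: op_cases => [i ip|].
  by rewrite shift_op_small // x_opE.
rewrite shift_op_last !shift_op_small // left_opE //.
apply: End_comb; [| exact: x_opE | exact: x_opE].
by rewrite (x_opE _ p_gt0) conj_opV_aX.
Qed.

(** Since x_op commutes with T and L a, hence with the operator Y(h^-1), its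
    powers can be computed inside a block. *)
Lemma x_op_iter h i n : (i < p)%N ->
  mexpV X n (e h i) = mexpV (Y h^-1%g) n (e h i).
Proof.
move=> ip; have XY := conj_op_comm h^-1%g x_op_shift x_op_left_a.
elim: n => // n IHn; rewrite (mexpSr algV (Y _)).
transitivity (X (mexpV X n (e h i))); first exact: comp_lfunE.
rewrite IHn (comm_at _ (mexp_comm algV n XY)) (x_opE h ip).
by apply/esym; apply: comp_lfunE.
Qed.

Lemma conj_op_pow g :
  mexpV (Y g) p = al *: (L (a ^+ p)%g - \1%VF) + al0 *: Y g.
Proof.
apply: (pow_rel g algV left_op1 left_opM shift_op_pow).
exact/esym/left_shift_comm.
Qed.

Lemma End_affineE (f g : 'End(V)) (b b' : k) v :
  (b *: (f - \1%VF) + b' *: g) v = b *: (f v - v) + b' *: g v.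
Proof. by rewrite !(add_lfunE, scale_lfunE, opp_lfunE) id_lfunE. Qed.

Lemma x_op_realizes : realizes p (@comp_lfun k V V V) \1%VF left_op x_op.
Proof.
split=> [|g h||g]; [exact: left_op1 | exact: left_opM | |].
  apply: End_ext => h i ip; rewrite x_op_iter // conj_op_pow.
  by rewrite (End_affineE _ (Y _)) (End_affineE _ X) x_opE.
apply: End_ext => h i ip.
(* L g commutes with all Y f and moves the block of g^-1 h to that of h, so that
   the conjugate of x_op by g acts on e(h, i) as Y(h^-1 g). *)
have LY f : (L g \o Y f = Y f \o L g)%VF.
  exact/conj_op_comm/left_a_comm/left_shift_comm.
have affineE (f : 'End(V)) (b c : k) v :
    (b *: f + c *: (L a - \1%VF)) v = b *: f v + c *: (L a v - v).
  by rewrite addrC End_affineE addrC.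
rewrite !comp_lfunE (left_opE _ _ ip) (x_opE _ ip).
rewrite (comm_at _ (LY _)) (left_opE _ _ ip) mulKVg invMg invgK.
rewrite (affineE x_op) (x_opE _ ip) !(affineE T) dchiM dcM.
move: (T _) (L a _ - _) => t s.
by rewrite scalerDr !scalerA scalerDl addrA mulrC.
Qed.

(** * Monomials, coproduct and antipode in an arbitrary realization *)

Section Realization.
Variables (A : lmodType k) (m : A -> A -> A) (u : A) (rho : dG F -> A) (x : A).
Hypotheses (alg_A : is_algebra m u) (real : realizes p m u rho x).

Let rho1 := realizes1 real.
Let rhoM := realizesM real.
Let mA := alg_assoc alg_A.
Let m1l := alg_unitl alg_A.
Let m1r := alg_unitr alg_A.
Let mDl := alg_mulDl alg_A.
Let mDr := alg_mulDr alg_A.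
Let mNl := alg_mulNl alg_A.
Let mNr := alg_mulNr alg_A.
Let mZl := alg_scalel alg_A.
Let mZr := alg_scaler alg_A.
Let expX := mexp m u x.

(** The conjugation relation for g^-1, multiplied by g on the left. *)
Lemma realizes_swap g : m x (rho g) =
  chi g^-1%g *: m (rho g) x + cc g^-1%g *: (rho (g * a)%g - rho g).
Proof.
have -> : m x (rho g) = m (rho g) (m (m (rho g^-1%g) x) (rho g)).
  by rewrite !mA -rhoM mulgV rho1 m1l.
have := realizes_conj real g^-1%g; rewrite invgK => ->.
by rewrite mDr !mZr mDr mNr m1r rhoM.
Qed.

Definition spanned (v : A) : Prop :=
  exists c : I -> k, v = \sum_i c i *: m (rho i.1) (expX i.2).

Lemma spanned_comb b v w : spanned v -> spanned w -> spanned (b *: v + w).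
Proof.
move=> [c ->] [d ->]; exists (fun i => b * c i + d i).
rewrite scaler_sumr -big_split; apply: eq_bigr => i _ /=.
by rewrite scalerDl scalerA.
Qed.

Lemma spanned0 : spanned 0.
Proof. by exists (fun => 0); rewrite big1 // => i _; rewrite scale0r. Qed.

Lemma spanned_scale b v : spanned v -> spanned (b *: v).
Proof. by move=> sv; rewrite -[b *: v]addr0; apply: spanned_comb spanned0. Qed.

Lemma spanned_add v w : spanned v -> spanned w -> spanned (v + w).
Proof. by move=> sv sw; rewrite -[v]scale1r; apply: spanned_comb. Qed.

Lemma spanned_sub v w : spanned v -> spanned w -> spanned (v - w).
Proof. by move=> sv sw; rewrite addrC -scaleN1r; apply: spanned_comb. Qed.

Lemma spanned_monomial g i : (i < p)%N -> spanned (m (rho g) (expX i)).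
Proof.
move=> ip; exists (fun j => (j == (g, Ordinal ip))%:R).
rewrite (bigD1 (g, Ordinal ip)) //= eqxx scale1r big1 ?addr0 // => j /negPf ->.
by rewrite scale0r.
Qed.

Lemma spanned_rho g : spanned (rho g).
Proof. by rewrite -[rho g]m1r; apply: (spanned_monomial g p_gt0). Qed.

Lemma spanned1 : spanned u.
Proof. by rewrite -rho1; apply: spanned_rho. Qed.

Lemma spanned_x : spanned x.
Proof.
by rewrite -[x]m1l -rho1 -[x in m _ x]m1r; apply: (spanned_monomial _ p_gt1).
Qed.

Lemma spanned_linear (f : A -> A) : linear f ->
  (forall g i, (i < p)%N -> spanned (f (m (rho g) (expX i)))) ->
  forall v, spanned v -> spanned (f v).
Proof.
move=> fL fs _ [c ->]; elim/big_rec: _ => [|j v _ sv].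
  by rewrite (linear_at0 fL); apply: spanned0.
by rewrite fL; apply: spanned_comb => //; apply: fs.
Qed.

Lemma spanned_rho_mul g v : spanned v -> spanned (m (rho g) v).
Proof.
apply: (spanned_linear ((alg_bilin alg_A).2 (rho g))) => h i ip.
by rewrite mA -rhoM; apply: spanned_monomial.
Qed.

Lemma spanned_x_mul v : spanned v -> spanned (m x v).
Proof.
apply: (spanned_linear ((alg_bilin alg_A).2 x)) => g i ip.
rewrite mA realizes_swap mDl !mZl mDl mNl -mA.
rewrite [m x (expX i)](_ : _ = expX i.+1) //.
apply: spanned_comb.
  case: (ltnP i.+1 p) => [|pi]; first exact: spanned_monomial.
  (* The exponent has reached p, which the power relation brings down to 1. *)
  have -> : i.+1 = p by apply/eqP; rewrite eqn_leq ip.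
  rewrite /expX (realizes_pow real); apply: spanned_rho_mul; apply: spanned_add.
    by apply/spanned_scale/spanned_sub; [apply: spanned_rho | apply: spanned1].
  exact/spanned_scale/spanned_x.
by apply/spanned_scale/spanned_sub; apply: spanned_monomial.
Qed.

Lemma realizes_x_a : m x (rho a) = m (rho a) x.
Proof.
by rewrite realizes_swap dchi_aV dc_aV scale1r scale0r addr0.
Qed.

Lemma alpha0_rho_aX : al0 *: rho (a ^+ p)%g = al0 *: rho a.
Proof. by case: alpha0_aX => [->|->]; rewrite ?scale0r. Qed.

Lemma alpha0_rho_aXV : al0 *: rho (a ^+ p)^-1%g = al0 *: rho a^-1%g.
Proof. by case: alpha0_aX => [->|->]; rewrite ?scale0r. Qed.

Lemma rhoX g n : mexp m u (rho g) n = rho (g ^+ n)%g.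
Proof. by elim: n => [|n IHn]; rewrite ?rho1 // expgS rhoM -IHn. Qed.

(** The affine combinations of z and r - 1 behave under the coproduct like the
    skew-primitive element z, because
      (r - 1) ⊗ r + 1 ⊗ (r - 1) = r ⊗ r - 1 ⊗ 1. *)
Lemma tens_skew_primitive b d r z :
  (b *: z + d *: (r - u)) ⊗ r + u ⊗ (b *: z + d *: (r - u)) =
  b *: (z ⊗ r + u ⊗ z) + d *: (r ⊗ r - u ⊗ u).
Proof.
have rL := @tens_linearl _ A A r; have uR := @tens_linearr _ A A u.
rewrite rL uR (linear_atZ rL) (linear_atZ uR) (linear_atB _ _ rL).
rewrite (linear_atB _ _ uR) addrACA -scalerDr -scalerDr.
by congr (_ + _ *: _); rewrite addrA subrK.
Qed.

Let algT : is_algebra (tens_mul m m) (u ⊗ u) := tens_is_algebra alg_A alg_A.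

(** The two summands of the element commute, so that its p-th power is
    x^p ⊗ a^p + 1 ⊗ x^p; the power and conjugation relations then both come from
    [tens_skew_primitive]. *)
Lemma Delta_realizes :
  realizes p (tens_mul m m) (u ⊗ u) (fun g => rho g ⊗ rho g)
           (x ⊗ rho a + u ⊗ x).
Proof.
have mTE := tens_mulE alg_A alg_A.
split=> [|g h||g]; first by rewrite rho1.
- by rewrite mTE rhoM.
- rewrite (mexpD_pchar algT char_k); last first.
    by rewrite (mTE x (rho a) u x) (mTE u x x (rho a)) m1l m1r realizes_x_a.
  rewrite !(tens_mexp alg_A alg_A) rhoX (mexp1 alg_A) (realizes_pow real).
  have x_tens : al0 *: (x ⊗ rho (a ^+ p)%g) = al0 *: (x ⊗ rho a).
    by rewrite -!(linear_atZ (tens_linearr x)) alpha0_rho_aX.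
  have swap (y z : A) : al *: y + al0 *: z = al0 *: z + al *: y := addrC _ _.
  apply: etrans (congr1 (fun y : A => y ⊗ rho (a ^+ p)%g + u ⊗ y)
                        (swap (rho (a ^+ p)%g - u) x)) _.
  apply: etrans (tens_skew_primitive _ _ _ _) _.
  apply: etrans (addrC _ _) (congr1 (+%R _) _).
  apply: etrans (scalerDr _ _ _) _.
  exact: etrans (congr1 (+%R^~ _) x_tens) (esym (scalerDr _ _ _)).
- rewrite (alg_mulDr algT) (alg_mulDl algT).
  rewrite (mTE (rho g) (rho g) x (rho a)) (mTE (rho g) (rho g) u x).
  rewrite (mTE (m (rho g) x) _ (rho g^-1%g)) (mTE (m (rho g) u)) m1r.
  rewrite (realizes_conj real) -!rhoM mulgV rho1 da_comm mulgK.
  exact: tens_skew_primitive.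
Qed.

(** As x commutes with a^-1, the p-th power of - x a^-1 is - x^p a^-p. *)
Lemma antipode_realizes :
  realizes p (fun v w => m w v) u (fun g => rho g^-1%g) (m (- x) (rho a^-1%g)).
Proof.
have x_aV : m x (rho a^-1%g) = m (rho a^-1%g) x.
  rewrite -[LHS]m1l -rho1 -(mulVg a) rhoM -mA (mA (rho a)) -realizes_x_a.
  by rewrite -mA -rhoM mulgV rho1 m1r.
have expE (y : A) n : mexp (fun v w => m w v) u y n = mexp m u y n.
  by elim: n => // n IHn; rewrite (mexpSr alg_A) -IHn.
split=> [|g h||g]; first by rewrite invg1 rho1.
- by rewrite invMg rhoM.
- rewrite expE (mexpM_comm alg_A); last by rewrite mNl mNr x_aV.
  rewrite (mexpN_pchar alg_A) // rhoX expgVn (realizes_pow real).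
  rewrite mNl mDl !mZl mDl !mNl m1l -rhoM mulgV rho1 opprD -!scalerN opprB.
  by congr (_ + _); rewrite !scalerN -!mZr alpha0_rho_aXV.
- have aV_gV : m (rho a^-1%g) (rho g^-1%g) = m (rho g^-1%g) (rho a^-1%g).
    by rewrite -!rhoM -!invMg da_comm.
  rewrite invgK -mA aV_gV !mA mNr !mNl (realizes_conj real).
  by rewrite mDl !mZl mDl mNl m1l -rhoM mulgV rho1 opprD -!scalerN opprB.
Qed.

End Realization.

Local Notation H := (HF p F).
Local Notation hg := (@HFg k p F).
Local Notation hx := (HFx p F).
Let algH := HF_is_algebra p F.
Let realH := HF_realizes p F.

Lemma HF_spanned v : exists c : I -> k, v = \sum_i c i *: (hg i.1 * hx ^+ i.2).
Proof.
suff [c ->] : spanned (@GRing.mul H) 1 hg hx v.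
  by exists c; apply: eq_bigr => i _; rewrite mexpE.
elim/HF_ind: v => [|b v w|g v|v].
- exact: (spanned1 algH realH).
- exact: spanned_comb.
- exact: (spanned_rho_mul algH realH).
- exact: (spanned_x_mul algH realH).
Qed.

(** Independence: the monomials map e(1, 0) to the basis vectors of the model. *)
Theorem HF_basis : is_basis (fun i : I => hg i.1 * hx ^+ i.2).
Proof.
split; last exact: HF_spanned.
have [Phi [PhiH Phig Phix]] := HF_lift End_is_algebra x_op_realizes.
have PhiX n : Phi (hx ^+ n) = mexpV x_op n.
  elim: n => [|n IHn]; first exact: (hom_unit PhiH).
  by rewrite exprS (hom_mul PhiH) IHn Phix.
have monomial_val g i : (i < p)%N ->
    (Phi (hg g * hx ^+ i) : 'End(V)) (e 1%g 0) = e g i.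
  move=> ip; rewrite (hom_mul PhiH) PhiX Phig comp_lfunE mexpVE.
  (* The operator x_op is the shift on the block of 1. *)
  have -> : iter i x_op (e 1%g 0) = e 1%g i.
    elim: i ip => // i IHi ip; rewrite iterS IHi ?(ltnW ip) //.
    rewrite x_opE ?(ltnW ip) // /conj_op invg1 dchi1 dc1 scale1r scale0r addr0.
    exact: shift_op_small.
  by rewrite left_opE // mulg1.
move=> c c0 j; pose ev (v : H) := (Phi v : 'End(V)) (e 1%g 0).
have evL : linear ev.
  by move=> b v w; rewrite /ev linearP add_lfunE scale_lfunE.
have ev_sum : ev (\sum_i c i *: (hg i.1 * hx ^+ i.2)) = \sum_i c i *: e i.1 i.2.
  elim/big_rec2: _ => [|i v w _ <-]; first exact: linear_at0.
  by rewrite evL /ev monomial_val.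
rewrite -(unit_vec_sum_coef c j) -ev_sum c0 (linear_at0 evL).
by rewrite ffunE.
Qed.

(** * The Hopf algebra H_F *)

Lemma counit_realizes :
  realizes p (fun b c : k^o => (b : k) * c) (1 : k^o) (fun _ : dG F => 1 : k^o)
           (0 : k^o).
Proof.
split=> [|g h||g] //; first by rewrite mulr1.
- rewrite subrr !scaler0 addr0; case: p p_gt0 => // n _.
  exact: mul0r.
- by rewrite mulr0 mul0r subrr !scaler0 addr0.
Qed.

End Compatibility.

Theorem lemma3p9 (k : fieldType) (p : nat) (char_k : p \in [pchar k])
  (F : datum k)
  (cond0 : dalpha0 F = 0 ->
     forall g : dG F, dc g *: (gbasis k (da F) ^+ p - 1) = 0)
  (cond1 : dalpha0 F = 1 ->
     (da F ^+ p)%g = da F /\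
     forall g : dG F,
       (in_prime_field (dchi g) /\ dchi g != 0) /\
       (dalpham1 F * (dchi g - 1) + dc g ^+ p - dc g)
         *: (gbasis k (da F) - 1) = 0) :
  is_basis (fun i : (dG F * 'I_p)%type => HFg p i.1 * HFx p F ^+ i.2) /\
  exists (Delta : {linear HF p F -> tensor (HF p F) (HF p F)})
         (eps : {linear HF p F -> k^o})
         (S : {linear HF p F -> HF p F}),
    [/\ forall (g : dG F) (i : 'I_p),
          Delta (HFg p g * HFx p F ^+ i) =
          tmul (@GRing.mul (HF p F)) (HFg p g ⊗ HFg p g)
            (texp (@GRing.mul (HF p F)) 1 (HFx p F ⊗ HFg p (da F) + (1 : HF p F) ⊗ HFx p F) i),
        forall (g : dG F) (i : 'I_p),
          eps (HFg p g * HFx p F ^+ i) = (i == 0%N :> nat)%:R,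
        forall (g : dG F) (i : 'I_p),
          S (HFg p g * HFx p F ^+ i) =
          (- HFx p F * HFg p (da F)^-1%g) ^+ i * HFg p g^-1%g
      & is_hopf_algebra (@GRing.mul (HF p F)) 1 Delta eps S].
Proof.
split; first exact: HF_basis.
have algH := HF_is_algebra p F; have realH := HF_realizes p F.
have algT := tens_is_algebra algH algH.
have DeltaR := Delta_realizes char_k cond1 algH realH.
have [Delta [DeltaH Delta_g Delta_x]] := HF_lift algT DeltaR.
have [eps [epsH eps_g eps_x]] :=
  HF_lift (scalars_is_algebra k) (counit_realizes F char_k).
have SR := antipode_realizes char_k cond1 algH realH.
have [S [SH S_g S_x]] := HF_lift (opp_is_algebra algH) SR.
exists Delta, eps, S; split=> [g i|g i|g i|].
- rewrite (hom_mul DeltaH) Delta_g; congr (tens_mul _ _ _ _).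
  elim: (i : nat) => [|n IHn]; first exact: (hom_unit DeltaH).
  by rewrite exprS (hom_mul DeltaH) IHn Delta_x.
- rewrite (hom_mul epsH) eps_g mul1r; case: (i : nat) => [|n].
    exact: (hom_unit epsH).
  by rewrite exprS (hom_mul epsH) eps_x mul0r.
- rewrite (hom_mul SH) S_g; congr (_ * _).
  elim: (i : nat) => [|n IHn]; first exact: (hom_unit SH).
  rewrite exprS (hom_mul SH) IHn S_x; exact/esym/exprSr.
- exact: (gen_hopf algH (realizes1 realH) (realizesM realH)
            (@HF_ind k p F) DeltaH Delta_g Delta_x epsH eps_g eps_x SH S_g S_x).
Qed.
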